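(* Let $k$ denote the maximum, over agents $a$, of the number of distinct costs among the programs on $a$'s preference list. The min-sum problem (given an instance as described in the context, compute an $\mathcal{A}$-perfect stable matching $M$ minimizing $\sum_{p\in\mathcal{B}}|M(p)|\cdot c(p)$) admits an $O(k^{|\mathcal{A}|})$ time algorithm.
   Context: An instance consists of a bipartite graph $G=(\mathcal{A}\cup\mathcal{B},E)$, where $\mathcal{A}$ is a set of agents, $\mathcal{B}$ a set of programs, and $(a,p)\in E$ iff $a$ and $p$ are mutually acceptable. Each agent ranks its neighbours in a strict order and each program ranks its neighbours in a strict order; $y>_x z$ means $x$ prefers $y$ to $z$. Each program $p$ has a non-negative integer cost $c(p)$; programs have no quotas. A matching $M\subseteq E$ assigns each agent to at most one program (a program may receive any number of agents); $M(a)$ is the program of $a$ and $M(p)$ the set of agents assigned to $p$. An agent prefers any acceptable program to being unmatched. A pair $(a,p)\in E\setminus M$ blocks $M$ if $p>_a M(a)$ and there is $a'\in M(p)$ with $a>_p a'$; $M$ is stable if no pair blocks it. $M$ is $\mathcal{A}$-perfect if every agent is matched.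
   Formalization: The bound is k^|A| times a polynomial in the input size, with k replaced by max(k,1). Literal O(k^|A|) fails: for one agent and n programs, one of cost 0 and the rest of cost 1, k^|A| = 2, but finding the cheapest program needs about n steps. *)

(* Defs.v *)
From mathcomp Require Import all_boot.

Set Implicit Arguments.
Unset Strict Implicit.
Unset Printing Implicit Defensive.

(** ** Instances and matchings *)

(** Preference lists are written most preferred first.  The edge set [E] is
    carried by the lists themselves: [(a, p)] is an edge iff [p] occurs on the
    list of [a], equivalently (last field) iff [a] occurs on the list of [p]. *)
Record instance := Instance {
  nA : nat;
  nB : nat;
  apref : 'I_nA -> seq 'I_nB;
  ppref : 'I_nB -> seq 'I_nA;
  cost : 'I_nB -> nat;
  apref_uniq : forall a, uniq (apref a);
  ppref_uniq : forall p, uniq (ppref p);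
  mutual : forall a p, (p \in apref a) = (a \in ppref p)
}.

Definition edge (I : instance) (a : 'I_(nA I)) (p : 'I_(nB I)) : bool :=
  p \in apref a.

(** [assignment I] are the candidate matchings; [None] means unmatched. *)
Definition assignment (I : instance) := {ffun 'I_(nA I) -> option 'I_(nB I)}.

Definition is_matching (I : instance) (M : assignment I) : bool :=
  [forall a, forall p, (M a == Some p) ==> edge a p].

Definition assigned (I : instance) (M : assignment I) (p : 'I_(nB I)) :
    {set 'I_(nA I)} :=
  [set a | M a == Some p].

(** These two comparisons are meaningful only between neighbours; they are
    used only on such. *)
Definition agent_prefers (I : instance) (a : 'I_(nA I)) (p : 'I_(nB I))
    (o : option 'I_(nB I)) : bool :=
  if o is Some q then index p (apref a) < index q (apref a) else true.

Definition program_prefers (I : instance) (p : 'I_(nB I))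
    (a a' : 'I_(nA I)) : bool :=
  index a (ppref p) < index a' (ppref p).

Definition blocks (I : instance) (M : assignment I)
    (a : 'I_(nA I)) (p : 'I_(nB I)) : bool :=
  [&& edge a p, M a != Some p, agent_prefers a p (M a)
    & [exists a' in assigned M p, program_prefers p a a']].

Definition stable (I : instance) (M : assignment I) : bool :=
  [forall a, forall p, ~~ blocks M a p].

Definition A_perfect (I : instance) (M : assignment I) : bool :=
  [forall a, M a != None].

Definition feasible (I : instance) (M : assignment I) : bool :=
  [&& is_matching M, stable M & A_perfect M].

Definition total_cost (I : instance) (M : assignment I) : nat :=
  \sum_(p < nB I) #|assigned M p| * cost p.

Definition minsum_optimal (I : instance) (M : assignment I) : Prop :=
  feasible M /\
  forall M' : assignment I, feasible M' -> total_cost M <= total_cost M'.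

Definition max_distinct_costs (I : instance) : nat :=
  \max_(a < nA I) size (undup [seq cost p | p <- apref a]).

(** ** Random access machine *)

(** A unit-cost RAM, programmed with structured control flow: registers and a
    memory with indirect addressing, all holding natural numbers, initially 0
    outside the input.  The arithmetic is addition and truncated subtraction
    only; without multiplication or shifts, [t] steps lengthen numbers by at
    most [t] bits, so unit cost agrees with bit cost up to a polynomial. *)
Record state := State { regs : nat -> nat; mem : nat -> nat }.

Definition upd (f : nat -> nat) (i v : nat) : nat -> nat :=
  fun j => if j == i then v else f j.

Definition set_reg (s : state) (r v : nat) : state :=
  State (upd (regs s) r v) (mem s).

Definition set_mem (s : state) (i v : nat) : state :=
  State (regs s) (upd (mem s) i v).

Inductive cmd :=
| Skip
| Const (r n : nat)
| Add (r x y : nat)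
| Sub (r x y : nat)
| Read (r x : nat)
| Write (x y : nat)
| Seq (c1 c2 : cmd)
| Cond (x : nat) (c1 c2 : cmd)
| While (x : nat) (c : cmd).

(** [exec c s t s']: run from [s], the program [c] halts in [s'] after exactly
    [t] steps.  A step is an elementary command or a test of a register
    against 0. *)
Inductive exec : cmd -> state -> nat -> state -> Prop :=
| exec_skip s : exec Skip s 1 s
| exec_const r n s : exec (Const r n) s 1 (set_reg s r n)
| exec_add r x y s :
    exec (Add r x y) s 1 (set_reg s r (regs s x + regs s y))
| exec_sub r x y s :
    exec (Sub r x y) s 1 (set_reg s r (regs s x - regs s y))
| exec_read r x s :
    exec (Read r x) s 1 (set_reg s r (mem s (regs s x)))
| exec_write x y s :
    exec (Write x y) s 1 (set_mem s (regs s x) (regs s y))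
| exec_seq c1 c2 s s1 s2 t1 t2 :
    exec c1 s t1 s1 -> exec c2 s1 t2 s2 -> exec (Seq c1 c2) s (t1 + t2) s2
| exec_cond_true x c1 c2 s s' t :
    regs s x != 0 -> exec c1 s t s' -> exec (Cond x c1 c2) s t.+1 s'
| exec_cond_false x c1 c2 s s' t :
    regs s x = 0 -> exec c2 s t s' -> exec (Cond x c1 c2) s t.+1 s'
| exec_while_done x c s :
    regs s x = 0 -> exec (While x c) s 1 s
| exec_while_step x c s s1 s2 t1 t2 :
    regs s x != 0 -> exec c s t1 s1 -> exec (While x c) s1 t2 s2 ->
    exec (While x c) s (t1 + t2).+1 s2.

Lemma exec_det c s t1 s1 t2 s2 :
  exec c s t1 s1 -> exec c s t2 s2 -> t1 = t2 /\ s1 = s2.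
Proof.
move=> e1; elim: e1 t2 s2 => {c s t1 s1}.
- by move=> s t2 s2 e; inversion e.
- by move=> r n s t2 s2 e; inversion e.
- by move=> r x y s t2 s2 e; inversion e.
- by move=> r x y s t2 s2 e; inversion e.
- by move=> r x s t2 s2 e; inversion e.
- by move=> x y s t2 s2 e; inversion e.
- move=> c1 c2 s s1 s2 t1 t2 _ IH1 _ IH2 t s' e; inversion e; subst.
  match goal with h : exec c1 _ _ _ |- _ => case: (IH1 _ _ h) => ? ? end; subst.
  by match goal with h : exec c2 _ _ _ |- _ => case: (IH2 _ _ h) => ? ? end; subst.
- move=> x c1 c2 s s' t nz _ IH t2 s2 e; inversion e; subst.
    by match goal with h : exec c1 _ _ _ |- _ => case: (IH _ _ h) => -> -> end.
  by match goal with h : regs s x = 0 |- _ => rewrite h in nz end.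
- move=> x c1 c2 s s' t z _ IH t2 s2 e; inversion e; subst.
    by match goal with h : is_true (regs s x != 0) |- _ => rewrite z in h end.
  by match goal with h : exec c2 _ _ _ |- _ => case: (IH _ _ h) => -> -> end.
- move=> x c s z t2 s2 e; inversion e; subst=> //.
  by match goal with h : is_true (regs _ x != 0) |- _ => rewrite z in h end.
- move=> x c s s1 s2 t1 t2 nz _ IH1 _ IH2 t s' e; inversion e; subst.
    by match goal with h : regs _ x = 0 |- _ => rewrite h in nz end.
  match goal with h : exec c _ _ _ |- _ => case: (IH1 _ _ h) => ? ? end; subst.
  by match goal with h : exec (While x c) _ _ _ |- _ =>
    case: (IH2 _ _ h) => ? ? end; subst.
Qed.

(** ** Input and output conventions *)

(** Adjacency lists, one number per word: [nA], [nB], the costs, then the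
    agents' and the programs' preference lists, each preceded by its length. *)
Definition encode (I : instance) : seq nat :=
  [:: nA I, nB I
    & [seq cost p | p <- enum 'I_(nB I)]
   ++ flatten [seq size (apref a) :: map val (apref a) | a <- enum 'I_(nA I)]
   ++ flatten [seq size (ppref p) :: map val (ppref p) | p <- enum 'I_(nB I)]].

Definition input_size (I : instance) : nat := size (encode I).

Definition initial_state (I : instance) : state :=
  State (fun _ => 0) (nth 0 (encode I)).

(** On halting, register 0 tells whether an A-perfect stable matching exists
    (nonzero) or not (0); if so, memory cell [a] holds the program of agent
    [a]. *)
Definition minsum_answer (I : instance) (s : state) : Prop :=
  if regs s 0 == 0 then forall M : assignment I, ~~ feasible M
  else exists M : assignment I,
    minsum_optimal M /\
    forall a : 'I_(nA I), exists2 p, M a = Some p & mem s a = p.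

(* Main.v *)
Require Import Defs.
From mathcomp Require Import all_boot zify.
Import Defs.

Set Implicit Arguments.
Unset Strict Implicit.
Unset Printing Implicit Defensive.

(** Choosing for every agent the cost of her program leaves at most
    [k ^ |A|] cases.  Within a case, every agent starts at her most preferred
    program of the chosen cost.  While some agent [i], currently at [p], is
    justifiably envied by an agent [a] (who prefers [p] to her current program
    and whom [p] prefers to [i]), agent [i] moves on to her next program of the
    same cost.  No feasible matching with the chosen costs assigns an agent
    before her current position, so this ends in a feasible matching whenever
    there is one, and the total cost is fixed by the case.  An odometer runs
    through the cases; its digits for an agent are the positions on her list at
    which a cost occurs for the first time.

    The RAM program is compiled from a language in which every loop runs over
    [0 .. B - 1] for one fixed [B], the input size, so that polynomial time is
    a matter of syntax; only the odometer is a genuine [While]. *)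

(** * Structured programs and their compilation *)

Inductive expr :=
| Num (n : nat)
| Var (x : nat)
| Plus (e1 e2 : expr)
| Minus (e1 e2 : expr)
| Get (e : expr)
| Ite (e e1 e2 : expr)
| Let (x : nat) (e1 e2 : expr)
| Find (x : nat) (e : expr)
| Iter (x i : nat) (e0 e1 : expr).

(** [Find x e] is the least [x < B] with [e] nonzero, or [B] if there is none;
    [Iter x i e0 e1] iterates [e1] on the accumulator [x] with counter [i]. *)
Fixpoint ev (B : nat) (e : expr) (env m : nat -> nat) : nat :=
  match e with
  | Num n => n
  | Var x => env x
  | Plus e1 e2 => ev B e1 env m + ev B e2 env m
  | Minus e1 e2 => ev B e1 env m - ev B e2 env m
  | Get e => m (ev B e env m)
  | Ite e e1 e2 =>
      if ev B e env m != 0 then ev B e1 env m else ev B e2 env m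
  | Let x e1 e2 => ev B e2 (upd env x (ev B e1 env m)) m
  | Find x e => find (fun i => ev B e (upd env x i) m != 0) (iota 0 B)
  | Iter x i e0 e1 =>
      iteri B (fun j acc => ev B e1 (upd (upd env x acc) i j) m) (ev B e0 env m)
  end.

Inductive stmt :=
| SSkip
| St (e1 e2 : expr)
| SSeq (s1 s2 : stmt)
| SIf (e : expr) (s1 s2 : stmt)
| For (x : nat) (s : stmt).

Fixpoint ss (B : nat) (c : stmt) (env m : nat -> nat) : nat -> nat :=
  match c with
  | SSkip => m
  | St e1 e2 => upd m (ev B e1 env m) (ev B e2 env m)
  | SSeq c1 c2 => ss B c2 env (ss B c1 env m)
  | SIf e c1 c2 => if ev B e env m != 0 then ss B c1 env m else ss B c2 env m
  | For x c => iteri B (fun j m' => ss B c (upd env x j) m') m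
  end.

Definition mov (r x z : nat) : cmd := Seq (Const z 0) (Add r x z).

(** Register 1 holds [B] and the variable [x] lives in register [rho x < r].
    The value goes to register [r]; registers above [r] are scratch. *)
Fixpoint comp (e : expr) (rho : nat -> nat) (r : nat) : cmd :=
  match e with
  | Num n => Const r n
  | Var x => mov r (rho x) r
  | Plus e1 e2 => Seq (comp e1 rho r) (Seq (comp e2 rho r.+1) (Add r r r.+1))
  | Minus e1 e2 => Seq (comp e1 rho r) (Seq (comp e2 rho r.+1) (Sub r r r.+1))
  | Get e => Seq (comp e rho r) (Read r r)
  | Ite e e1 e2 => Seq (comp e rho r) (Cond r (comp e1 rho r) (comp e2 rho r))
  | Let x e1 e2 =>
      Seq (comp e1 rho r) (Seq (comp e2 (upd rho x r) r.+1) (mov r r.+1 r))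
  | Find x e =>
      Seq (Const r 0) (Seq (mov r.+1 1 r.+1) (While r.+1
        (Seq (comp e (upd rho x r) r.+2)
          (Cond r.+2 (Const r.+1 0)
            (Seq (Const r.+2 1) (Seq (Add r r r.+2) (Sub r.+1 r.+1 r.+2)))))))
  | Iter x i e0 e1 =>
      Seq (comp e0 rho r) (Seq (Const r.+1 0) (Seq (mov r.+2 1 r.+2) (While r.+2
        (Seq (comp e1 (upd (upd rho x r) i r.+1) r.+3)
          (Seq (mov r r.+3 r) (Seq (Const r.+3 1)
            (Seq (Add r.+1 r.+1 r.+3) (Sub r.+2 r.+2 r.+3))))))))
  end.

Fixpoint compS (c : stmt) (rho : nat -> nat) (r : nat) : cmd :=
  match c with
  | SSkip => Skip
  | St e1 e2 => Seq (comp e1 rho r) (Seq (comp e2 rho r.+1) (Write r r.+1))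
  | SSeq c1 c2 => Seq (compS c1 rho r) (compS c2 rho r)
  | SIf e c1 c2 => Seq (comp e rho r) (Cond r (compS c1 rho r) (compS c2 rho r))
  | For x c =>
      Seq (Const r 0) (Seq (mov r.+1 1 r.+1) (While r.+1
        (Seq (compS c (upd rho x r) r.+2)
          (Seq (Const r.+2 1) (Seq (Add r r r.+2) (Sub r.+1 r.+1 r.+2))))))
  end.

(** An upper bound depending on [B] and the syntax only: both branches of a conditional are charged,
    and every loop all of its [B] rounds. *)
Fixpoint tm (B : nat) (e : expr) : nat :=
  match e with
  | Num n => 1
  | Var x => 2
  | Plus e1 e2 => tm B e1 + tm B e2 + 1
  | Minus e1 e2 => tm B e1 + tm B e2 + 1
  | Get e => tm B e + 1
  | Ite e e1 e2 => tm B e + tm B e1 + tm B e2 + 1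
  | Let x e1 e2 => tm B e1 + tm B e2 + 2
  | Find x e => 4 + B * (tm B e + 6)
  | Iter x i e0 e1 => tm B e0 + 4 + B * (tm B e1 + 6)
  end.

Fixpoint tmS (B : nat) (c : stmt) : nat :=
  match c with
  | SSkip => 1
  | St e1 e2 => tm B e1 + tm B e2 + 1
  | SSeq c1 c2 => tmS B c1 + tmS B c2
  | SIf e c1 c2 => tm B e + tmS B c1 + tmS B c2 + 1
  | For x c => 4 + B * (tmS B c + 4)
  end.

(** * Timed total-correctness triples for the machine *)

Definition runs (c : cmd) (s : state) (T : nat) (Q : state -> Prop) : Prop :=
  exists t s', [/\ exec c s t s', t <= T & Q s'].

Lemma runs_weaken c s T T' (Q Q' : state -> Prop) :
  T <= T' -> (forall s', Q s' -> Q' s') -> runs c s T Q -> runs c s T' Q'.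
Proof.
move=> leT QQ' [t [s' [ex le q]]]; exists t, s'; split=> //; last exact: QQ'.
exact: leq_trans leT.
Qed.

Lemma runs_seq c1 c2 s T1 T2 (Q : state -> Prop) :
  runs c1 s T1 (fun s1 => runs c2 s1 T2 Q) -> runs (Seq c1 c2) s (T1 + T2) Q.
Proof.
move=> [t1 [s1 [e1 l1 [t2 [s2 [e2 l2 q]]]]]].
by exists (t1 + t2), s2; split; [exact: exec_seq e1 e2 | exact: leq_add |].
Qed.

Lemma runs_const r n s (Q : state -> Prop) :
  Q (set_reg s r n) -> runs (Const r n) s 1 Q.
Proof. by move=> q; exists 1, (set_reg s r n); split=> //; constructor. Qed.

Lemma runs_add r x y s (Q : state -> Prop) :
  Q (set_reg s r (regs s x + regs s y)) -> runs (Add r x y) s 1 Q.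
Proof. by move=> q; exists 1; eexists; split=> //; [constructor | exact: q]. Qed.

Lemma runs_sub r x y s (Q : state -> Prop) :
  Q (set_reg s r (regs s x - regs s y)) -> runs (Sub r x y) s 1 Q.
Proof. by move=> q; exists 1; eexists; split=> //; [constructor | exact: q]. Qed.

Lemma runs_read r x s (Q : state -> Prop) :
  Q (set_reg s r (mem s (regs s x))) -> runs (Read r x) s 1 Q.
Proof. by move=> q; exists 1; eexists; split=> //; [constructor | exact: q]. Qed.

Lemma runs_write x y s (Q : state -> Prop) :
  Q (set_mem s (regs s x) (regs s y)) -> runs (Write x y) s 1 Q.
Proof. by move=> q; exists 1; eexists; split=> //; [constructor | exact: q]. Qed.

Lemma runs_mov r x z s (Q : state -> Prop) : x != z ->
  Q (set_reg (set_reg s z 0) r (regs s x)) -> runs (mov r x z) s 2 Q.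
Proof.
move=> nxz q; apply: (@runs_seq _ _ _ 1 1); apply: runs_const; apply: runs_add.
by rewrite /= /upd (negbTE nxz) eqxx addn0.
Qed.

Lemma runs_cond x c1 c2 s T1 T2 (Q : state -> Prop) :
  (if regs s x != 0 then runs c1 s T1 Q else runs c2 s T2 Q) ->
  runs (Cond x c1 c2) s (T1 + T2 + 1) Q.
Proof.
case: ifPn => [nz | /negPn/eqP z] [t [s' [ex le q]]].
  by exists t.+1, s'; split=> //; [exact: exec_cond_true | lia].
by exists t.+1, s'; split=> //; [exact: exec_cond_false | lia].
Qed.

(** Here [k] bounds the remaining rounds. The body may lower it by more than one, which lets a
    search stop early by dropping it to 0. *)
Lemma runs_while x c s k T (Inv : nat -> state -> Prop) (Q : state -> Prop) :
  Inv k s ->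
  (forall n s1, Inv n s1 -> if regs s1 x != 0 then
     exists2 n', n = n'.+1 & runs c s1 T (fun s2 => exists2 n2, n2 <= n' & Inv n2 s2)
   else Q s1) ->
  runs (While x c) s (k * (T + 1) + 1) Q.
Proof.
move=> + step; elim/ltn_ind: k s => k IH s /[dup] inv /step.
case: ifPn => [nz [n' kE [t1 [s1 [e1 l1 [n2 le2 inv1]]]]] | /negPn/eqP z q].
  have /IH/(_ s1 inv1) [t2 [s2 [e2 l2 q]]] : n2 < k by rewrite kE ltnS.
  exists (t1 + t2).+1, s2; split=> //; first exact: exec_while_step e1 e2.
  have : n2 * (T + 1) <= n' * (T + 1) by rewrite leq_mul2r le2 orbT.
  by rewrite kE mulSn; lia.
exists 1, s; split=> //; [exact: exec_while_done | lia].
Qed.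

Definition agree (r : nat) (s s' : state) := forall y, y < r -> regs s' y = regs s y.

(** The compilation invariant. It mentions no register from [r] on, so code that preserves the
    registers below [r] preserves it. *)
Definition interp (B r : nat) (rho env : nat -> nat) (s : state) : Prop :=
  [/\ 1 < r, regs s 1 = B & forall x, rho x < r /\ regs s (rho x) = env x].

Lemma interp_agree B r rho env s s' :
  interp B r rho env s -> agree r s s' -> interp B r rho env s'.
Proof.
case=> r1 sB h ag; split=> //; first by rewrite ag.
by move=> x; case: (h x) => lt e; rewrite ag.
Qed.

Lemma interp_le B r r' rho env s :
  interp B r rho env s -> r <= r' -> interp B r' rho env s.
Proof.
case=> r1 sB h le; split=> //; first exact: leq_trans le.
by move=> x; case: (h x) => lt e; split=> //; apply: leq_trans le.
Qed.

Lemma interp_upd B r q rho env s x v :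
  interp B r rho env s -> q < r -> regs s q = v ->
  interp B r (upd rho x q) (upd env x v) s.
Proof.
by case=> r1 sB h lt qv; split=> // y; rewrite /upd; case: eqP.
Qed.

Ltac regs_tac :=
  rewrite /= /upd; repeat (case: eqP => ? //=); try by lia.

Definition comp_spec B e := forall rho r env s, interp B r rho env s ->
  runs (comp e rho r) s (tm B e) (fun s' =>
    [/\ mem s' = mem s, agree r s s' & regs s' r = ev B e env (mem s)]).

(** Induction on [e]: a subexpression compiled at a higher base register cannot disturb intermediate
    results kept below that base. *)
Lemma comp_correct B e : comp_spec B e.
Proof.
elim: e => [n|x|e1 IH1 e2 IH2|e1 IH1 e2 IH2|e IH|e IH e1 IH1 e2 IH2|x e1 IH1 e2 IH2
  |x e IH|x i e0 IH0 e1 IH1] rho r env s hi /=.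
- apply: runs_const; split=> //=; last by regs_tac.
  by move=> y lt; regs_tac.
- case: (hi) => r1 _ /(_ x) [lt e]; apply: runs_mov; first by lia.
  split=> //; last by regs_tac.
  by move=> y lty; regs_tac.
1,2: rewrite -addnA; apply: runs_seq; apply: runs_weaken (IH1 _ _ _ _ hi) => // s1 [m1 a1 v1];
  have hi1 := interp_agree hi a1;
  apply: runs_seq; apply: runs_weaken (IH2 _ _ _ _ (interp_le hi1 (leqnSn r))) => // s2 [m2 a2 v2];
  (apply: runs_add || apply: runs_sub); split; [by rewrite /= m2 |
    by move=> y lt; rewrite -(a1 _ lt) -a2 ?ltnS ?(ltnW lt) //; regs_tac |
    by rewrite /= /upd eqxx v2 m1 a2 // v1].
- apply: runs_seq; apply: runs_weaken (IH _ _ _ _ hi) => // s1 [m1 a1 v1].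
  apply: runs_read; split=> //; last by rewrite /= /upd eqxx v1 m1.
  by move=> y lt; rewrite -a1 //; regs_tac.
- rewrite -2!addnA addnA -addnA; apply: runs_seq.
  apply: runs_weaken (IH _ _ _ _ hi) => // s1 [m1 a1 v1].
  have hi1 := interp_agree hi a1.
  rewrite addnA; apply: runs_cond; rewrite v1; case: (_ != 0).
    apply: runs_weaken (IH1 _ _ _ _ hi1) => // s2 [m2 a2 v2].
    split; [by rewrite m2 | by move=> y lt; rewrite a2 // a1 | by rewrite v2 m1].
  apply: runs_weaken (IH2 _ _ _ _ hi1) => // s2 [m2 a2 v2].
  split; [by rewrite m2 | by move=> y lt; rewrite a2 // a1 | by rewrite v2 m1].
- rewrite -addnA; apply: runs_seq; apply: runs_weaken (IH1 _ _ _ _ hi) => // s1 [m1 a1 v1].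
  have hi1 := interp_agree hi a1.
  have hi2 := interp_upd x (interp_le hi1 (leqnSn r)) (ltnSn r) v1.
  apply: runs_seq; apply: runs_weaken (IH2 _ _ _ _ hi2) => // s2 [m2 a2 v2].
  apply: runs_mov; first by lia.
  split; [by rewrite /= m2 | | by rewrite /= /upd eqxx v2 m1].
  by move=> y lt; rewrite -(a1 _ lt) -a2 ?ltnS ?(ltnW lt) //; regs_tac.
(* The bound is regrouped to follow the nesting of the compiled code, so that each rule consumes one
   summand. *)
- have -> : 4 + B * (tm B e + 6) = 1 + (2 + (B * (tm B e + (1 + 3 + 1) + 1) + 1)).
    by rewrite -(addnA (tm B e)); lia.
  case: (hi) => r1 sB _.
  apply: runs_seq; apply: runs_const; apply: runs_seq; apply: runs_mov; first by lia.
  set p := fun i => ev B e (upd env x i) (mem s) != 0.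
  (* Either the search has succeeded and its counter is cleared, or all values below the content of
     register [r] have failed and [k] are left. *)
  pose Inv k s1 := [/\ mem s1 = mem s, agree r s s1, regs s1 r.+1 = k &
    regs s1 r = find p (iota 0 B) /\ k = 0 \/
    regs s1 r + k = B /\ ~~ has p (iota 0 (regs s1 r))].
  apply: (@runs_while _ _ _ B _ Inv).
    split=> //.
    + by move=> y lt; regs_tac.
    + by rewrite /= /upd eqxx; regs_tac.
    + by right; split; regs_tac.
  move=> n s1 [m1 a1 kE inv]; rewrite kE; case: eqP => [n0 | /eqP n0] /=.
    split=> //; case: inv => [[] //|[sum nh]].
    by move: sum nh; rewrite n0 addn0 => -> nh; rewrite (hasNfind nh) size_iota.
  case: inv => [[_ n0']|[sum nh]]; first by rewrite n0' in n0.
  case: n => [|n] // in kE n0 sum *; exists n => //.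
  apply: runs_seq.
  have hi1 := interp_agree hi a1.
  have hi2 : interp B r.+2 (upd rho x r) (upd env x (regs s1 r)) s1.
    by apply: interp_upd => //; apply: interp_le hi1 _; lia.
  apply: runs_weaken (IH _ _ _ _ hi2) => // s2 [m2 a2 v2].
  have iotaE : iota 0 B = iota 0 (regs s1 r) ++ regs s1 r :: iota (regs s1 r).+1 n.
    by rewrite -sum iotaD.
  have a2' : agree r s s2 by move=> y lt; rewrite -a1 // -a2 //; lia.
  have rr2 : regs s2 r = regs s1 r by rewrite a2 //; lia.
  have rr3 : regs s2 r.+1 = n.+1 by rewrite a2 //; lia.
  rewrite m1 in v2.
  apply: runs_cond; rewrite v2; case: ifPn => [pv | npv].
    apply: runs_const; exists 0 => //; split=> //.
    + by rewrite /= m2.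
    + by move=> y lt; rewrite -a2' //; regs_tac.
    + by regs_tac.
    + left; split=> //; rewrite iotaE find_cat (negbTE nh) /= /p pv addn0 size_iota.
      by rewrite -rr2; regs_tac.
  apply: (@runs_seq _ _ _ 1 2); apply: runs_const; apply: (@runs_seq _ _ _ 1 1); apply: runs_add.
  apply: runs_sub; exists n => //.
  have rE : regs s2 r + 1 = (regs s1 r).+1 by rewrite rr2 addn1.
  split.
  + by rewrite /= m2.
  + by move=> y lt; rewrite -a2' //; regs_tac.
  + by move: rr3; regs_tac.
  + right.
    set w := regs _ r; have -> : w = (regs s1 r).+1 by rewrite -rE /w; regs_tac.
    split; first by lia.
    by rewrite -addn1 iotaD has_cat (negbTE nh) /= orbF.
- have -> : tm B e0 + 4 + B * (tm B e1 + 6) =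
      tm B e0 + (1 + (2 + (B * (tm B e1 + (2 + (1 + (1 + 1))) + 1) + 1))).
    by rewrite -(addnA (tm B e1)); lia.
  apply: runs_seq; apply: runs_weaken (IH0 _ _ _ _ hi) => // s0 [m0 a0 v0].
  have hi0 := interp_agree hi a0; case: (hi0) => r1 sB _.
  apply: runs_seq; apply: runs_const; apply: runs_seq; apply: runs_mov; first by lia.
  set f := fun j acc => ev B e1 (upd (upd env x acc) i j) (mem s).
  pose Inv k s1 := [/\ mem s1 = mem s, agree r s s1, regs s1 r.+2 = k,
    regs s1 r.+1 + k = B & regs s1 r = iteri (regs s1 r.+1) f (ev B e0 env (mem s))].
  apply: (@runs_while _ _ _ B _ Inv).
    split=> //.
    + by move=> y lt; rewrite -a0 //; regs_tac.
    + by rewrite /= /upd eqxx; regs_tac.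
    + by regs_tac.
    + by rewrite /= -v0; regs_tac.
  move=> n s1 [m1 a1 kE sum v1]; rewrite kE; case: eqP => [n0 | /eqP n0] /=.
    by split=> //; rewrite v1; move: sum; rewrite n0 addn0 => ->.
  case: n => [|n] // in kE n0 sum *; exists n => //.
  apply: runs_seq.
  have hi1 := interp_agree hi a1.
  have hi2 : interp B r.+3 (upd (upd rho x r) i r.+1)
      (upd (upd env x (regs s1 r)) i (regs s1 r.+1)) s1.
    apply: interp_upd => //; apply: interp_upd => //; last by lia.
    by apply: interp_le hi1 _; lia.
  apply: runs_weaken (IH1 _ _ _ _ hi2) => // s2 [m2 a2 v2].
  have a2' : agree r s s2 by move=> y lt; rewrite -a1 // -a2 //; lia.
  have rr3 : regs s2 r.+1 = regs s1 r.+1 by rewrite a2 //; lia.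
  have rr4 : regs s2 r.+2 = n.+1 by rewrite a2 //; lia.
  rewrite m1 in v2.
  apply: runs_seq; apply: runs_mov; first by lia.
  apply: runs_seq; apply: runs_const; apply: (@runs_seq _ _ _ 1 1).
  apply: runs_add; apply: runs_sub; exists n => //.
  set s3 := set_reg _ _ _.
  have e1' : regs s3 r.+1 = (regs s1 r.+1).+1 by rewrite -[RHS]addn1 -rr3 /s3; regs_tac.
  have e0' : regs s3 r = regs s2 r.+3 by rewrite /s3; regs_tac.
  split.
  + by rewrite /= m2.
  + by move=> y lt; rewrite -a2' // /s3; regs_tac.
  + by move: rr4; rewrite /s3; regs_tac.
  + by rewrite e1'; lia.
  + by rewrite e1' e0' v2 /= v1.
Qed.

Lemma compS_correct B c rho r env s : interp B r rho env s ->
  runs (compS c rho r) s (tmS B c) (fun s' =>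
    mem s' = ss B c env (mem s) /\ agree r s s').
Proof.
elim: c rho r env s => [|e1 e2|c1 IH1 c2 IH2|e c1 IH1 c2 IH2|x c IH] rho r env s hi /=.
- by exists 1, s; split=> //; constructor.
- rewrite -addnA; apply: runs_seq; apply: runs_weaken (comp_correct e1 hi) => // s1 [m1 a1 v1].
  have hi1 := interp_agree hi a1.
  apply: runs_seq; apply: runs_weaken (comp_correct e2 (interp_le hi1 (leqnSn r))) => // s2 [m2 a2 v2].
  apply: runs_write; split; first by rewrite /= m2 m1 v2 m1 a2 // v1.
  by move=> y lt; rewrite -a1 // -a2 //; lia.
- apply: runs_seq; apply: runs_weaken (IH1 _ _ _ _ hi) => // s1 [m1 a1].
  apply: runs_weaken (IH2 _ _ _ _ (interp_agree hi a1)) => // s2 [m2 a2].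
  by split=> [|y lt]; [rewrite m2 m1 | rewrite a2 // a1].
- rewrite -2!addnA; apply: runs_seq; apply: runs_weaken (comp_correct e hi) => // s1 [m1 a1 v1].
  have hi1 := interp_agree hi a1.
  rewrite addnA; apply: runs_cond; rewrite v1 -m1; case: (_ != 0).
    apply: runs_weaken (IH1 _ _ _ _ hi1) => // s2 [m2 a2].
    by split=> // y lt; rewrite a2 // a1.
  apply: runs_weaken (IH2 _ _ _ _ hi1) => // s2 [m2 a2].
  by split=> // y lt; rewrite a2 // a1.
- have -> : 4 + B * (tmS B c + 4) = 1 + (2 + (B * (tmS B c + (1 + (1 + 1)) + 1) + 1)).
    by rewrite -(addnA (tmS B c)); lia.
  case: (hi) => r1 sB _.
  apply: runs_seq; apply: runs_const; apply: runs_seq; apply: runs_mov; first by lia.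
  set f := fun j m' => ss B c (upd env x j) m'.
  pose Inv k s1 := [/\ mem s1 = iteri (regs s1 r) f (mem s), agree r s s1,
    regs s1 r.+1 = k & regs s1 r + k = B].
  apply: (@runs_while _ _ _ B _ Inv).
    split=> //.
    + by rewrite [regs _ r](_ : _ = 0) //; regs_tac.
    + by move=> y lt; regs_tac.
    + by rewrite /= /upd eqxx; regs_tac.
    + by regs_tac.
  move=> n s1 [m1 a1 kE sum]; rewrite kE; case: eqP => [n0 | /eqP n0] /=.
    by split=> //; rewrite m1; move: sum; rewrite n0 addn0 => ->.
  case: n => [|n] // in kE n0 sum *; exists n => //.
  apply: runs_seq.
  have hi1 := interp_agree hi a1.
  have hi2 : interp B r.+2 (upd rho x r) (upd env x (regs s1 r)) s1.
    by apply: interp_upd => //; apply: interp_le hi1 _; lia.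
  apply: runs_weaken (IH _ _ _ _ hi2) => // s2 [m2 a2].
  have a2' : agree r s s2 by move=> y lt; rewrite -a1 // -a2 //; lia.
  have rr2 : regs s2 r = regs s1 r by rewrite a2 //; lia.
  have rr3 : regs s2 r.+1 = n.+1 by rewrite a2 //; lia.
  apply: runs_seq; apply: runs_const; apply: (@runs_seq _ _ _ 1 1).
  apply: runs_add; apply: runs_sub; exists n => //.
  set s3 := set_reg _ _ _.
  have e0' : regs s3 r = (regs s1 r).+1 by rewrite -[RHS]addn1 -rr2 /s3; regs_tac.
  split.
  + by rewrite e0' /= m2 m1.
  + by move=> y lt; rewrite -a2' // /s3; regs_tac.
  + by move: rr3; rewrite /s3; regs_tac.
  + by rewrite e0'; lia.
Qed.

(** * Polynomial bounds in the loop bound *)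

Definition poly (f : nat -> nat) := exists C d, forall B, f B <= C * B.+1 ^ d.

Lemma poly_const c : poly (fun=> c).
Proof. by exists c, 0 => B; rewrite expn0 muln1. Qed.

Lemma poly_id : poly id.
Proof. by exists 1, 1 => B; rewrite expn1; lia. Qed.

Lemma poly_add f g : poly f -> poly g -> poly (fun B => f B + g B).
Proof.
move=> [C [d h]] [C' [d' h']]; exists (C + C'), (d + d') => B.
rewrite mulnDl; apply: leq_add.
  by apply: leq_trans (h B) _; rewrite leq_mul2l leq_pexp2l ?orbT // leq_addr.
by apply: leq_trans (h' B) _; rewrite leq_mul2l leq_pexp2l ?orbT // leq_addl.
Qed.

Lemma poly_mul f g : poly f -> poly g -> poly (fun B => f B * g B).
Proof.
move=> [C [d h]] [C' [d' h']]; exists (C * C'), (d + d') => B.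
by rewrite expnD mulnACA; apply: leq_mul.
Qed.

Ltac poly_tac := repeat (apply: poly_add || apply: poly_mul || apply: poly_const
  || apply: poly_id || assumption).

Lemma poly_tm e : poly (tm^~ e).
Proof. by elim: e => *; rewrite /=; poly_tac. Qed.

Lemma poly_tmS c : poly (tmS^~ c).
Proof. by elim: c => [|e1 e2|c1 h1 c2 h2|e c1 h1 c2 h2|x c h] /=; poly_tac; apply: poly_tm. Qed.

(** * Matchings as vectors of list positions *)

Definition lists (I : instance) : seq (seq nat) :=
  [seq map val (apref a) | a <- enum 'I_(nA I)] ++
  [seq map val (ppref p) | p <- enum 'I_(nB I)].

Definition pl (I : instance) (l : nat) : seq nat := nth [::] (lists I) l.

Definition cst (I : instance) (p : nat) : nat :=
  nth 0 [seq cost q | q <- enum 'I_(nB I)] p.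

(** The address of the length word of list [l], past the two counts and the costs. At [nA I + nB I]
    it is the input size. *)
Definition off (I : instance) (l : nat) : nat :=
  2 + nB I + sumn [seq (size x).+1 | x <- take l (lists I)].

Lemma nth_flatten_blocks (ls : seq (seq nat)) l k :
  l < size ls -> k <= size (nth [::] ls l) ->
  nth 0 (flatten [seq size x :: x | x <- ls])
    (sumn [seq (size x).+1 | x <- take l ls] + k) =
  nth 0 (size (nth [::] ls l) :: nth [::] ls l) k.
Proof.
elim: ls l k => [|x ls IH] [|l] k //= lt le.
  by rewrite add0n; case: k le => //= k le; rewrite nth_cat le.
by rewrite -addnA nth_cat ltnNge leq_addr /= addKn IH.
Qed.

Lemma encodeE I : encode I = [:: nA I, nB I & [seq cost p | p <- enum 'I_(nB I)] ++
  flatten [seq size x :: x | x <- lists I]].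
Proof.
rewrite /encode /lists map_cat flatten_cat -!map_comp.
by congr [:: _, _ & _ ++ flatten _ ++ flatten _]; apply: eq_map => x /=; rewrite size_map.
Qed.

Lemma size_lists I : size (lists I) = nA I + nB I.
Proof. by rewrite /lists size_cat 2!size_map !size_enum_ord. Qed.

Lemma input_sizeE I : input_size I = off I (nA I + nB I).
Proof.
rewrite /input_size encodeE /off -size_lists take_size /= size_cat size_map size_enum_ord.
by rewrite size_flatten /shape -map_comp.
Qed.

Lemma offS I l : l < nA I + nB I -> off I l.+1 = off I l + (size (pl I l)).+1.
Proof.
rewrite -size_lists => lt.
by rewrite /off (take_nth [::] lt) map_rcons sumn_rcons addnA.
Qed.

Lemma off_mono I l l' : l <= l' -> l' <= nA I + nB I -> off I l <= off I l'.
Proof.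
move=> + le'; elim: l' le' => [|l' IH] lt; first by rewrite leqn0 => /eqP->.
rewrite leq_eqVlt => /orP[/eqP-> //|]; rewrite ltnS => le; have := IH (ltnW lt) le.
by rewrite offS //; lia.
Qed.

Lemma off_size I l : l < nA I + nB I -> off I l + size (pl I l) < input_size I.
Proof.
move=> lt; rewrite input_sizeE -addnS -offS //.
exact: off_mono.
Qed.

Lemma off_ge I l : l <= nA I + nB I -> 2 + nB I + l <= off I l.
Proof.
elim: l => [|l IH] lt; first by rewrite addn0 leq_addr.
by rewrite offS //; move: (IH (ltnW lt)); lia.
Qed.

Lemma input_size_ge I : 2 + nB I + (nA I + nB I) <= input_size I.
Proof. by rewrite input_sizeE off_ge. Qed.

Lemma encode_list I l k : l < nA I + nB I -> k <= size (pl I l) ->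
  nth 0 (encode I) (off I l + k) = nth 0 (size (pl I l) :: pl I l) k.
Proof.
rewrite -size_lists => lt le.
rewrite encodeE /off -!addnA /= nth_cat size_map size_enum_ord.
by rewrite add0n ltnNge leq_addr /= addKn nth_flatten_blocks.
Qed.

Lemma encode_cost I p : p < nB I -> nth 0 (encode I) (2 + p) = cst I p.
Proof. by move=> lt; rewrite /= nth_cat size_map size_enum_ord lt. Qed.

Lemma pl_agent I (a : 'I_(nA I)) : pl I a = map val (apref a).
Proof.
by rewrite /pl /lists nth_cat size_map size_enum_ord ltn_ord
  (nth_map a) ?size_enum_ord // nth_ord_enum.
Qed.

Lemma pl_program I (p : 'I_(nB I)) : pl I (nA I + p) = map val (ppref p).
Proof.
rewrite /pl /lists nth_cat size_map size_enum_ord ltnNge leq_addr addKn.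
by rewrite (nth_map p) ?size_enum_ord // nth_ord_enum.
Qed.

Lemma cstE I (p : 'I_(nB I)) : cst I p = cost p.
Proof. by rewrite /cst (nth_map p) ?size_enum_ord // nth_ord_enum. Qed.

Lemma pl_agent_lt I a p : a < nA I -> p \in pl I a -> p < nB I.
Proof. move=> lt; rewrite -[a]/(val (Ordinal lt)) pl_agent => /mapP[q _ ->]; exact: ltn_ord. Qed.

Lemma pl_mutual I a p : a < nA I -> p \in pl I a -> a \in pl I (nA I + p).
Proof.
move=> lt; rewrite -[a]/(val (Ordinal lt)) pl_agent => /mapP[q + ->].
by rewrite pl_program (mem_map val_inj) mutual.
Qed.

(** A perfect matching is given by the vector [c] of the positions of the
    agents' programs on their lists. *)
Definition viol (I : instance) (c : nat -> nat) (i : nat) : bool :=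
  let p := nth 0 (pl I i) (c i) in
  has (fun a => [&& p \in pl I a, index p (pl I a) < c a &
                    index a (pl I (nA I + p)) < index i (pl I (nA I + p))])
    (iota 0 (nA I)).

Definition good (I : instance) (c : nat -> nat) : Prop :=
  forall a, a < nA I -> c a < size (pl I a) /\ ~~ viol I c a.

Definition costc (I : instance) (c : nat -> nat) : nat :=
  \sum_(0 <= a < nA I) cst I (nth 0 (pl I a) (c a)).

(** Translates between the two descriptions of a perfect matching; under it, feasibility and cost
    become [good] and [costc]. *)
Definition link (I : instance) (M : assignment I) (c : nat -> nat) : Prop :=
  forall a : 'I_(nA I), exists p, [/\ M a = Some p, p \in apref a & c a = index p (apref a)].

Lemma link_nth I (M : assignment I) c (a : 'I_(nA I)) p :
  link M c -> M a = Some p -> nth 0 (pl I a) (c a) = p.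
Proof.
move=> /(_ a) [q [-> pa ->]] [<-].
by rewrite pl_agent (nth_map q) ?index_mem // nth_index.
Qed.

(** The agent [i] serves as the less preferred partner in the blocking condition. That the envious
    agent is not already at [p] follows from the strictness of her preference. *)
Lemma link_viol I (M : assignment I) c (i : 'I_(nA I)) p : link M c -> M i = Some p ->
  viol I c i = [exists a, [&& blocks M a p & program_prefers p a i]].
Proof.
move=> lk Mi; rewrite /viol (link_nth lk Mi); apply/hasP/existsP.
  case=> a; rewrite mem_iota add0n /= => lt; rewrite -[a]/(val (Ordinal lt)).
  move: (Ordinal lt) => {lt}a; rewrite pl_agent pl_program mem_map ?index_map; try exact: val_inj.
  case/and3P => pa ix pp.
  have pp' : program_prefers p a i := pp.
  exists a; rewrite pp' andbT /blocks /edge pa.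
  have [q [Mq qa cq]] := lk a; rewrite cq in ix.
  rewrite Mq /= ix /=; apply/andP; split.
    by apply/eqP => -[qp]; rewrite qp ltnn in ix.
  by apply/existsP; exists i; rewrite inE Mi eqxx.
case=> a /andP[/and4P[pa _ pref _] pp]; exists (val a); first by rewrite mem_iota /= add0n ltn_ord.
rewrite pl_agent pl_program mem_map ?index_map; try exact: val_inj.
rewrite [p \in _]pa /=; apply/andP; split=> //.
by have [q [Mq qa ->]] := lk a; rewrite Mq in pref.
Qed.

Lemma link_stable I (M : assignment I) c : link M c ->
  stable M <-> (forall i, i < nA I -> ~~ viol I c i).
Proof.
move=> lk; split=> [st i lt | nv].
  rewrite -[i]/(val (Ordinal lt)); have [p [Mp _ _]] := lk (Ordinal lt).
  rewrite (link_viol lk Mp); apply/existsP => -[a /andP[bl _]].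
  by move/forallP/(_ a)/forallP/(_ p): st; rewrite bl.
apply/forallP => a; apply/forallP => p; apply/negP => bl.
have /and4P[_ _ _ /existsP[i /andP[]]] := bl; rewrite inE => /eqP Mi pp.
have := nv i (ltn_ord i); rewrite (link_viol lk Mi) => /existsP[].
by exists a; rewrite bl.
Qed.

Lemma link_cost I (M : assignment I) c : link M c -> total_cost M = costc I c.
Proof.
move=> lk; rewrite /total_cost /costc big_mkord.
(* Cardinalities become sums of ones, so that the sums over programs and agents can be exchanged. *)
under eq_bigr => p _ do rewrite /assigned -sum1_card big_distrl /=.
rewrite (exchange_big_dep xpredT) //=; apply: eq_bigr => a _.
have [p [Mp _ _]] := lk a.
rewrite (link_nth lk Mp) cstE (big_pred1 p) ?mul1n // => q.
by rewrite inE Mp /= eq_sym.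
Qed.

Lemma link_feasible I (M : assignment I) c : link M c -> feasible M <-> good I c.
Proof.
move=> lk; split=> [/and3P[_ st _] i lt | gd].
  split; last by have /(link_stable lk) -> := st.
  rewrite -[i]/(val (Ordinal lt)); have [p [_ pa ->]] := lk (Ordinal lt).
  by rewrite pl_agent size_map index_mem.
apply/and3P; split.
- apply/forallP => a; apply/forallP => p; apply/implyP => /eqP Mp.
  by have [q [Mq qa _]] := lk a; move: Mp qa; rewrite Mq => -[->].
- by apply/(link_stable lk) => i /gd[].
- by apply/forallP => a; have [p [-> _ _]] := lk a.
Qed.

Lemma good_link I c : good I c -> exists M : assignment I, link M c.
Proof.
move=> gd; exists [ffun a : 'I_(nA I) => insub (nth 0 (pl I a) (c a))] => a.
rewrite ffunE; have [lt _] := gd a (ltn_ord a).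
move: (lt); rewrite pl_agent size_map => lt'.
case: (apref a) (apref_uniq a) lt' => [//|p0 l] un lt'.
exists (nth p0 (p0 :: l) (c a)).
by rewrite (nth_map p0) // valK mem_nth // index_uniq.
Qed.

Lemma feasible_link I (M : assignment I) : feasible M -> exists c, link M c.
Proof.
case/and3P=> mt _ pf.
exists (fun x => if insub x is Some a then
   if M a is Some p then index p (apref a) else 0 else 0) => a.
rewrite valK; case Ma: (M a) => [p|]; last by move/forallP/(_ a): pf; rewrite Ma.
exists p; split=> //.
by move/forallP/(_ a)/forallP/(_ p): mt; rewrite Ma eqxx.
Qed.

(** * Enumerating the cost choices *)

Lemma find_iotaP (p : pred nat) B :
  (find p (iota 0 B) < B -> p (find p (iota 0 B))) /\
  (forall y, y < B -> p y -> find p (iota 0 B) <= y).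
Proof.
split=> [lt | y lt py].
  have hp : has p (iota 0 B) by rewrite has_find size_iota.
  by have := nth_find 0 hp; rewrite nth_iota.
rewrite leqNgt; apply/negP => /(before_find 0).
by rewrite nth_iota // py.
Qed.

Section Odometer.
Variables (r : nat -> pred nat) (n : nat -> nat).

(** The rank of position [x] among the admissible ones. Counting starts at 1 because position 0 is
    always admissible and has rank 0; hence also the successor in [rad]. *)
Definition dig a x := count (r a) (iota 1 x).
Definition rad a := (count (r a) (iota 1 (n a).-1)).+1.

Fixpoint weight k := if k is k'.+1 then weight k' * rad k' else 1.

(** The mixed-radix number with digits [dig], agent 0 being least significant. *)
Fixpoint value k (s : nat -> nat) :=
  if k is k'.+1 then value k' s + weight k' * dig k' (s k') else 0.

(** Position 0 is a digit even on an empty list, so that [rad] is positive. *)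
Definition digit_ok a x := x = 0 \/ x < n a /\ r a x.

Lemma dig_le a x y : x <= y -> dig a x <= dig a y.
Proof. by move=> le; rewrite /dig -(subnKC le) iotaD count_cat leq_addr. Qed.

Lemma digS a x : dig a x.+1 = dig a x + r a x.+1.
Proof. by rewrite /dig -[x.+1]addn1 iotaD count_cat /= addn0 add1n addn1. Qed.

Lemma dig_lt_rad a x : digit_ok a x -> dig a x < rad a.
Proof.
case=> [-> //|[lt _]]; rewrite ltnS; apply: dig_le; lia.
Qed.

Lemma dig_inj a x y : digit_ok a x -> digit_ok a y -> dig a x = dig a y -> x = y.
Proof.
have gt u v : u < v -> digit_ok a v -> dig a u < dig a v.
  case: v => // v; rewrite ltnS => le [//|[_ rv]].
  by rewrite digS rv addn1 ltnS; apply: dig_le.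
move=> okx oky e; case: (ltngtP x y) => // lt.
  by have := gt _ _ lt oky; rewrite e ltnn.
by have := gt _ _ lt okx; rewrite e ltnn.
Qed.

(** No admissible position is skipped by the search, so it raises the digit by exactly one, or fails
    when the digit is already maximal. *)
Lemma dig_next a x B (v := find (fun y => [&& x < y, y < n a & r a y]) (iota 0 B)) :
  n a <= B -> digit_ok a x ->
  if v < B then [/\ v < n a, r a v & dig a v = (dig a x).+1]
  else (dig a x).+1 = rad a.
Proof.
pose p y := [&& x < y, y < n a & r a y]; move=> nB okx; have [h1 h2] := find_iotaP p B.
have none y : x <= y -> (forall z, x < z <= y -> ~~ r a z) -> dig a y = dig a x.
  elim: y => [|y IH]; first by rewrite leqn0 => /eqP->.
  rewrite leq_eqVlt => /orP[/eqP-> //|]; rewrite ltnS => le h.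
  rewrite digS (negbTE (h _ _)) ?addn0 ?IH //; last by rewrite ltnS le leqnn.
  by move=> z hz; apply: h; lia.
rewrite -/p -/v in h1 h2; case: ltnP => vB.
  have /and3P[xv vn rv] := h1 vB; split=> //.
  case: v xv vn rv h2 {h1} vB => // v xv vn rv h2 vB.
  rewrite digS rv addn1 none // => z /andP[xz zv]; apply/negP => rz.
  have zn : z < n a by lia.
  by have := h2 z; rewrite /p xz rz zn => /(_ (leq_trans zn nB) isT); lia.
rewrite /rad -/(dig a _) none //.
  by case: okx => [->|[]] //; lia.
move=> z /andP[xz zn]; apply/negP => rz.
have zn' : z < n a by lia.
by have := h2 z; rewrite /p xz rz zn' => /(_ (leq_trans zn' nB) isT); lia.
Qed.

Lemma weight_gt0 k : 0 < weight k.
Proof. by elim: k => //= k IH; rewrite muln_gt0 IH. Qed.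

Lemma value_lt k s : (forall a, a < k -> digit_ok a (s a)) -> value k s < weight k.
Proof.
elim: k => //= k IH ok.
have h1 : value k s < weight k by apply: IH => a lt; apply: ok; apply: ltnW.
have h2 := dig_lt_rad (ok k (ltnSn k)).
apply: (@leq_trans (weight k * (dig k (s k)).+1)); last by rewrite leq_mul2l h2 orbT.
by rewrite mulnS ltn_add2r.
Qed.

(** Uniqueness of the mixed-radix representation: quotient and remainder modulo [weight k] separate
    the top digit from the lower ones. *)
Lemma value_inj k s u : (forall a, a < k -> digit_ok a (s a)) ->
  (forall a, a < k -> digit_ok a (u a)) ->
  value k s = value k u -> forall a, a < k -> s a = u a.
Proof.
elim: k => //= k IH oks oku e.
have hs : forall a, a < k -> digit_ok a (s a) by move=> a lt; apply: oks; apply: ltnW.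
have hu : forall a, a < k -> digit_ok a (u a) by move=> a lt; apply: oku; apply: ltnW.
have := congr1 (divn^~ (weight k)) e; have := congr1 (modn^~ (weight k)) e.
rewrite ![_ + weight k * _]addnC ![weight k * _]mulnC !modnMDl !divnMDl ?weight_gt0 //.
rewrite !modn_small ?divn_small ?value_lt // !addn0 => e1 e2 a.
rewrite ltnS leq_eqVlt => /orP[/eqP->|]; last exact: IH.
by apply: dig_inj e2; [exact: oks | exact: oku].
Qed.

Lemma eq_value k s u : (forall a, a < k -> s a = u a) -> value k s = value k u.
Proof.
elim: k => //= k IH h; rewrite h // IH // => a lt.
by apply: h; apply: ltnW.
Qed.

Lemma value0 k s : (forall a, a < k -> s a = 0) -> value k s = 0.
Proof.
elim: k => //= k IH h; rewrite h // IH /= ?muln0 // => a lt.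
by apply: h; apply: ltnW.
Qed.

End Odometer.

(** * First occurrences of costs as digits, and the number of cases *)

Definition costs (I : instance) (a : nat) : seq nat := map (cst I) (pl I a).

Definition rep (I : instance) (a x : nat) : bool :=
  index (nth 0 (costs I a) x) (costs I a) == x.

Definition psize (I : instance) (a : nat) : nat := size (pl I a).

Lemma size_costs I a : size (costs I a) = psize I a.
Proof. exact: size_map. Qed.

(** First occurrences carry pairwise distinct costs. The maximum with 1 covers an empty list, whose
    single digit is 0. *)
Lemma rad_le I (a : 'I_(nA I)) :
  rad (rep I) (psize I) a <= maxn (max_distinct_costs I) 1.
Proof.
rewrite /rad; case E: (psize I a) => [|k] /=; first by rewrite leq_maxr.
apply: leq_trans (leq_maxl _ _).
apply: (@leq_trans (size (undup (costs I a)))).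
  have -> : (count (rep I a) (iota 1 k)).+1 = count (rep I a) (iota 0 k.+1).
    rewrite /= [rep I a 0](_ : _ = true) //.
    by move: (size_costs I a); rewrite E /rep; case: (costs I a) => [|c l] //= _; rewrite eqxx.
  (* Mapping each first occurrence to its cost is injective, since the cost determines the
     position. *)
  rewrite -size_filter -(size_map (nth 0 (costs I a))); apply: uniq_leq_size.
    rewrite map_inj_in_uniq ?filter_uniq ?iota_uniq // => x y.
    rewrite !mem_filter /rep => /andP[/eqP hx _] /andP[/eqP hy _] e.
    by rewrite -hx -hy e.
  move=> c /mapP[x]; rewrite mem_filter mem_iota => /andP[_ lt] ->.
  by rewrite mem_undup mem_nth // size_costs E.
rewrite /max_distinct_costs.
apply: leq_trans (leq_bigmax a); rewrite /costs pl_agent -map_comp.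
by rewrite (_ : map _ _ = map (@cost I) (apref a)) //; apply: eq_map => p /=; rewrite cstE.
Qed.

Lemma weight_le I : weight (rep I) (psize I) (nA I) <= maxn (max_distinct_costs I) 1 ^ nA I.
Proof.
have h k : k <= nA I -> weight (rep I) (psize I) k <= maxn (max_distinct_costs I) 1 ^ k.
  elim: k => //= k IH lt; rewrite expnSr leq_mul ?IH // ?(ltnW lt) //.
  exact: (rad_le (Ordinal lt)).
exact: h.
Qed.

(** The odometer position of agent [a] in the case to which [c] belongs. *)
Definition first_pos (I : instance) (c : nat -> nat) (a : nat) : nat :=
  index (nth 0 (costs I a) (c a)) (costs I a).

Lemma first_pos_ok I c a : c a < psize I a ->
  digit_ok (rep I) (psize I) a (first_pos I c a).
Proof.
rewrite -size_costs => lt; right; rewrite -size_costs index_mem mem_nth //.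
by rewrite /rep /first_pos nth_index ?mem_nth.
Qed.

(** * The algorithm *)

(** Variables are numbered so that no construct captures a variable of its
    arguments; variable 0 is never bound and always denotes [B]. *)
Definition Bnd := Var 0.
(** Truth is being nonzero, so truncated subtraction already is a comparison. *)
Definition Lt e1 e2 := Minus e2 e1.
Definition And e1 e2 := Ite e1 e2 (Num 0).
Definition Not e := Ite e (Num 0) (Num 1).
Definition Eq e1 e2 := Not (Plus (Minus e1 e2) (Minus e2 e1)).
Definition NA := Get (Num 0).

(** Hops from block to block, starting at the first list and reading each length; rounds with index
    [e] or more leave the address alone. *)
Definition Off e := Let 1 e (Iter 2 3 (Plus (Num 2) (Get (Num 1)))
  (Ite (Lt (Var 3) (Var 1)) (Plus (Plus (Var 2) (Num 1)) (Get (Var 2))) (Var 2))).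
Definition Len e := Get (Off e).
Definition Elt l x := Get (Plus (Off l) (Plus x (Num 1))).
(** An absent [v] gets rank [Bnd], longer than every list, so comparing the rank with the length
    tests membership. *)
Definition Rank l v := Let 4 l (Let 5 v (Find 6
  (And (Lt (Var 6) (Len (Var 4))) (Eq (Elt (Var 4) (Var 6)) (Var 5))))).
Definition CostAt a x := Get (Plus (Num 2) (Elt a x)).

(** Memory above the input: the odometer at [B], the current positions at [2B],
    the programs of the best matching so far at [3B], and at [4B] three cells:
    whether a matching was found, its cost, and the carry of the odometer. *)
Definition StartA a := Plus Bnd a.
Definition CurA a := Plus Bnd (Plus Bnd a).
Definition BestA a := Plus Bnd (Plus Bnd (Plus Bnd a)).
Definition Cell k := Plus Bnd (Plus Bnd (Plus Bnd (Plus Bnd (Num k)))).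
Definition Cur a := Get (CurA a).

(** A search that stops before [Bnd] acts as an existential quantifier. *)
Definition Viol i := Let 7 i (Let 8 (Elt (Var 7) (Cur (Var 7)))
  (Lt (Find 9 (And (Lt (Var 9) NA) (Let 10 (Rank (Var 9) (Var 8))
    (And (Lt (Var 10) (Len (Var 9))) (And (Lt (Var 10) (Cur (Var 9)))
      (Lt (Rank (Plus NA (Var 8)) (Var 9)) (Rank (Plus NA (Var 8)) (Var 7))))))))
   Bnd)).

(** If no program of the same cost remains, the result is [Bnd], beyond the list; the agent then
    stays invalid and [Ok] rejects the case. *)
Definition NextSame i := Let 7 i (Let 11 (Cur (Var 7)) (Find 12
  (And (Lt (Var 11) (Var 12)) (And (Lt (Var 12) (Len (Var 7)))
    (Eq (CostAt (Var 7) (Var 12)) (CostAt (Var 7) (Var 11))))))).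

(** The search carries no length test: it stops at [x] at the latest. *)
Definition IsRep a x := Not (Lt (Find 18 (Eq (CostAt a (Var 18)) (CostAt a x))) x).

Definition NextRep i := Let 7 i (Let 11 (Get (StartA (Var 7))) (Find 12
  (And (Lt (Var 11) (Var 12)) (And (Lt (Var 12) (Len (Var 7)))
    (IsRep (Var 7) (Var 12)))))).

Definition Valid i := Lt (Cur i) (Len i).

Definition bump :=
  SIf (And (Lt (Var 13) NA) (And (Valid (Var 13)) (Viol (Var 13))))
    (St (CurA (Var 13)) (NextSame (Var 13))) SSkip.
Definition round := For 13 bump.
Definition copy_start := For 14 (St (CurA (Var 14)) (Get (StartA (Var 14)))).
Definition rounds := For 14 round.

Definition Ok := Not (Lt (Find 15 (And (Lt (Var 15) NA)
  (Ite (Valid (Var 15)) (Viol (Var 15)) (Num 1)))) Bnd).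
Definition Sum := Iter 16 17 (Num 0)
  (Ite (Lt (Var 17) NA) (Plus (Var 16) (CostAt (Var 17) (Cur (Var 17)))) (Var 16)).

Definition save_best :=
  SSeq (For 14 (St (BestA (Var 14)) (Elt (Var 14) (Cur (Var 14)))))
    (SSeq (St (Cell 1) Sum) (St (Cell 0) (Num 1))).
Definition update :=
  SIf (And Ok (Ite (Get (Cell 0)) (Lt Sum (Get (Cell 1))) (Num 1))) save_best SSkip.

(** Either the digit advances and the carry is cleared, or the digit is reset and the carry passes
    on. A carry left after all agents means that the cases are exhausted. *)
Definition carry_step :=
  SIf (And (Lt (Var 14) NA) (Get (Cell 2)))
    (SIf (Lt (NextRep (Var 14)) Bnd)
       (SSeq (St (StartA (Var 14)) (NextRep (Var 14))) (St (Cell 2) (Num 0)))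
       (St (StartA (Var 14)) (Num 0)))
    SSkip.
Definition advance := SSeq (St (Cell 2) (Num 1)) (For 14 carry_step).

Definition body := SSeq copy_start (SSeq rounds (SSeq update advance)).

(** This overwrites the input, so it must follow the whole enumeration. *)
Definition output := For 14 (St (Var 14) (Get (BestA (Var 14)))).

(** * Values of the expressions of the algorithm *)

Definition inp (I : instance) (m : nat -> nat) :=
  forall x, x < input_size I -> m x = nth 0 (encode I) x.

Lemma find_iotaE (p q : pred nat) B : (forall x, x < B -> p x = q x) ->
  find p (iota 0 B) = find q (iota 0 B).
Proof.
move=> h; have : {in iota 0 B, p =1 q} by move=> x; rewrite mem_iota => /h.
elim: (iota 0 B) => //= x l IH hx; rewrite hx ?mem_head // IH // => y yl.
by apply: hx; rewrite inE yl orbT.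
Qed.

Lemma find_iota_first (p : pred nat) B k : k < B -> p k ->
  (forall y, y < k -> ~~ p y) -> find p (iota 0 B) = k.
Proof.
move=> lt pk h; have [h1 h2] := find_iotaP p B.
have le := h2 k lt pk; apply/eqP; rewrite eqn_leq le leqNgt; apply/negP => lt'.
by move: (h _ lt'); rewrite h1 // (leq_trans lt') // ltnW.
Qed.

Lemma find_iota_none (p : pred nat) B : (forall y, y < B -> ~~ p y) ->
  find p (iota 0 B) = B.
Proof.
move=> h; rewrite hasNfind ?size_iota //; apply/hasPn => y.
by rewrite mem_iota => /h.
Qed.

Lemma index_nth_le (l : seq nat) y : index (nth 0 l y) l <= y.
Proof.
rewrite leqNgt; apply/negP => /(before_find 0).
by rewrite /= eqxx.
Qed.

Lemma ltB e1 e2 B env m : (ev B (Lt e1 e2) env m != 0) = (ev B e1 env m < ev B e2 env m).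
Proof. by rewrite /= subn_eq0 ltnNge. Qed.

Lemma andB e1 e2 B env m :
  (ev B (And e1 e2) env m != 0) = (ev B e1 env m != 0) && (ev B e2 env m != 0).
Proof. by rewrite /=; case: (ev B e1 env m != 0). Qed.

Lemma notB e B env m : (ev B (Not e) env m != 0) = ~~ (ev B e env m != 0).
Proof. by rewrite /=; case: (ev B e env m != 0). Qed.

Lemma eqB e1 e2 B env m : (ev B (Eq e1 e2) env m != 0) = (ev B e1 env m == ev B e2 env m).
Proof. by rewrite notB negbK /= addn_eq0 !subn_eq0 -eqn_leq. Qed.

(** The bound [B] need not be the input size, only large enough for the loop: [Off] is also used to
    compute the input size itself. *)
Lemma ev_Off I m e B env : inp I m -> ev B e env m <= B -> ev B e env m <= nA I + nB I ->
  ev B (Off e) env m = off I (ev B e env m).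
Proof.
move=> im; rewrite [ev B (Off e) env m]/=; set i := ev B e env m => iB iK.
have szI := input_size_ge I.
rewrite /upd /= im; last by lia.
set f := fun j acc : nat => _.
suff h k : iteri k f (2 + nB I) = off I (minn k i) by rewrite h (minn_idPr iB).
elim: k => [|k IH]; first by rewrite min0n /off take0 /= addn0.
rewrite /= IH /f subn_eq0 -ltnNge; case: ltnP => ki /=; last by rewrite (minn_idPr _) // ltnW.
rewrite (minn_idPl ki) offS; last by lia.
have lt : k < nA I + nB I by lia.
rewrite im; last by move: (off_size lt); lia.
by rewrite -[X in nth 0 _ X]addn0 encode_list //= addn1 addnS addSn.
Qed.


Opaque Lt And Not Eq Off.

Lemma encode_pl I l k : l < nA I + nB I -> k <= size (pl I l) ->
  off I l + k < input_size I.
Proof. by move=> /off_size lt le; apply: leq_ltn_trans lt; rewrite leq_add2l. Qed.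

Lemma psize_lt I l : l < nA I + nB I -> size (pl I l) < input_size I.
Proof. by move/off_size; apply: leq_ltn_trans; rewrite leq_addl. Qed.

Section Eval.
Variables (I : instance) (B : nat) (m : nat -> nat).
Hypothesis BE : B = input_size I.
Hypothesis im : inp I m.

Let szI : 2 + nB I + (nA I + nB I) <= B.
Proof. by rewrite BE input_size_ge. Qed.

Let imE x : x < B -> m x = nth 0 (encode I) x.
Proof. by rewrite BE => /im. Qed.

Lemma ev_NA env : ev B NA env m = nA I.
Proof. by rewrite /= imE //; lia. Qed.

Let m0 : m 0 = nA I := ev_NA id.

Lemma ev_Len env e l : ev B e env m = l -> l < nA I + nB I ->
  ev B (Len e) env m = size (pl I l).
Proof.
move=> el lt; rewrite /Len /= (ev_Off im) ?el; [|lia|lia].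
have := encode_list lt (leq0n _); have := encode_pl lt (leq0n _).
by rewrite addn0 -BE => /imE-> ->.
Qed.

Lemma ev_Elt env e e' l x : ev B e env m = l -> ev B e' env m = x ->
  l < nA I + nB I -> x < size (pl I l) ->
  ev B (Elt e e') env m = nth 0 (pl I l) x.
Proof.
move=> el ex lt ltx; rewrite /Elt /= (ev_Off im) ?el ?ex; [|lia|lia].
by rewrite addn1 imE ?BE ?encode_pl // encode_list.
Qed.

Opaque Len Elt.

Lemma ev_CostAt env e e' a x : ev B e env m = a -> ev B e' env m = x ->
  a < nA I -> x < size (pl I a) ->
  ev B (CostAt e e') env m = nth 0 (costs I a) x.
Proof.
move=> el ex lt ltx; rewrite /CostAt [LHS]/= (ev_Elt el ex) //; last by lia.
have pB : nth 0 (pl I a) x < nB I := pl_agent_lt lt (mem_nth 0 ltx).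
rewrite imE; last by lia.
by rewrite /costs (nth_map 0) // -(encode_cost pB).
Qed.

Opaque CostAt.

Lemma ev_Rank env e e' l v :
  ev B e env m = l -> ev B e' (upd env 4 l) m = v -> l < nA I + nB I -> v < B ->
  ev B (Rank e e') env m = if v \in pl I l then index v (pl I l) else B.
Proof.
move=> el ev' lt vB; have szB := psize_lt lt; rewrite -BE in szB.
rewrite /Rank /= el ev'.
under find_iotaE => x xB.
  rewrite andB ltB eqB (@ev_Len _ _ l) //=.
  over.
rewrite /= /upd /=; case: ifPn => [vl | vnl].
  have ltv : index v (pl I l) < size (pl I l) by rewrite index_mem.
  apply: find_iota_first; first exact: ltn_trans szB.
    by rewrite ltv (@ev_Elt _ _ _ l (index v (pl I l))) // nth_index //=.
  move=> y ylt; have ys : y < size (pl I l) := ltn_trans ylt ltv.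
  rewrite ys (@ev_Elt _ _ _ l y) //=; apply/negP => /eqP yv.
  by move: (ylt); rewrite ltnNge -yv index_nth_le.
apply: find_iota_none => y yB; case: ltnP => //= ys.
rewrite (@ev_Elt _ _ _ l y) //=; apply/negP => /eqP yv.
by rewrite -yv mem_nth in vnl.
Qed.

Opaque Rank.

Let c a := m (B + (B + a)).

Lemma ev_Cur env e a : env 0 = B -> ev B e env m = a -> ev B (Cur e) env m = c a.
Proof. by move=> /= -> ->. Qed.

Opaque Cur.

Lemma ev_Valid env e a : env 0 = B -> ev B e env m = a -> a < nA I ->
  (ev B (Valid e) env m != 0) = (c a < size (pl I a)).
Proof.
move=> e0 ea lt; rewrite ltB (ev_Cur e0 ea) (@ev_Len _ _ a) //; lia.
Qed.

Lemma ev_Viol env e i : env 0 = B -> ev B e env m = i -> i < nA I ->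
  c i < size (pl I i) -> (ev B (Viol e) env m != 0) = viol I c i.
Proof.
move=> e0 ei lti lts; rewrite /Viol /= ei.
have iK : i < nA I + nB I by lia.
rewrite (@ev_Elt _ _ _ i (c i)) //; last exact: ev_Cur.
set p := nth 0 (pl I i) (c i).
have pi : p \in pl I i by rewrite mem_nth.
have pB : p < nB I := pl_agent_lt lti pi.
have step x : x < nA I -> ev B (Let 10 (Rank (Var 9) (Var 8))
    (And (Lt (Var 10) (Len (Var 9))) (And (Lt (Var 10) (Cur (Var 9)))
      (Lt (Rank (Plus NA (Var 8)) (Var 9)) (Rank (Plus NA (Var 8)) (Var 7))))))
    (upd (upd (upd env 7 i) 8 p) 9 x) m != 0 =
  [&& p \in pl I x, index p (pl I x) < c x &
      index x (pl I (nA I + p)) < index i (pl I (nA I + p))].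
  move=> ltx; have xK : x < nA I + nB I by lia.
  rewrite [ev _ _ _ _]/= (@ev_Rank _ _ _ x p) //; last by lia.
  rewrite !andB !ltB (@ev_Len _ _ x) // (@ev_Cur _ _ x) //.
  rewrite (@ev_Rank _ _ _ (nA I + p) x) //; [|by rewrite /= m0|lia|lia].
  rewrite (@ev_Rank _ _ _ (nA I + p) i) //; [|by rewrite /= m0|lia|lia].
  rewrite /= /upd /=; case: ifPn => [px | npx] /=.
    by rewrite index_mem px /= !pl_mutual.
  (* An agent who does not list [p] gets rank [B] for it, which fails the comparison with her list
     length. *)
  by have h := psize_lt xK; rewrite -BE in h; rewrite ltnNge (ltnW h).
have e0' : upd (upd env 7 i) 8 p 0 = B := e0.
rewrite /viol -/p ltB [ev B Bnd _ _]/= e0'.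
rewrite [ev B (Find _ _) _ _]/=.
rewrite -[X in _ < X](size_iota 0 B) -has_find.
apply/hasP/hasP => -[x]; rewrite mem_iota add0n /= => xlt.
  rewrite andB ltB ev_NA => /andP[ltx]; rewrite step // => h.
  by exists x; rewrite // mem_iota.
move=> h; exists x; first by rewrite mem_iota /=; lia.
by rewrite andB ltB ev_NA step // h andbT.
Qed.

Lemma ev_NextSame env e i : env 0 = B -> ev B e env m = i -> i < nA I ->
  c i < size (pl I i) ->
  ev B (NextSame e) env m = find (fun y => [&& c i < y, y < psize I i &
    nth 0 (costs I i) y == nth 0 (costs I i) (c i)]) (iota 0 B).
Proof.
move=> e0 ei lti lts; rewrite /NextSame [LHS]/= ei (@ev_Cur _ _ i) //.
apply: find_iotaE => y yB; rewrite !andB !ltB eqB (@ev_Len _ _ i) //; last by lia.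
rewrite -/(psize I i) [ev B (Var 12) _ _]/= [ev B (Var 11) _ _]/=; congr andb.
case: ltnP => //= ys.
by rewrite (@ev_CostAt _ _ _ i y) // (@ev_CostAt _ _ _ i (c i)) //.
Qed.

(** The search binds variable 18, so both arguments must keep their values under any binding of
    it. *)
Lemma ev_IsRep env e e' a x : ev B e' env m = x ->
  (forall y, ev B e (upd env 18 y) m = a) -> (forall y, ev B e' (upd env 18 y) m = x) ->
  a < nA I -> x < psize I a -> (ev B (IsRep e e') env m != 0) = rep I a x.
Proof.
move=> ex ea ex' lt xs; have xs' := xs; rewrite -size_costs in xs'.
have szB : psize I a < B by rewrite BE psize_lt //; lia.
rewrite /IsRep notB ltB ex -leqNgt [ev _ _ _ _]/=.
set p := fun y => _; have [h1 h2] := find_iotaP p B.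
have pE y : y < psize I a -> p y = (nth 0 (costs I a) y == nth 0 (costs I a) x).
  by move=> ys; rewrite /p eqB (@ev_CostAt _ _ _ a y) // (@ev_CostAt _ _ _ a x).
rewrite /rep; apply/idP/eqP => [le | eqx].
  apply/eqP; rewrite eqn_leq index_nth_le (leq_trans le) //; apply: h2.
    by apply: leq_ltn_trans (index_nth_le _ _) _; apply: ltn_trans szB.
  by rewrite pE ?nth_index ?mem_nth // -size_costs index_mem mem_nth.
rewrite leqNgt; apply/negP => lt'.
have := h1 (ltn_trans lt' (ltn_trans xs szB)); rewrite pE ?(ltn_trans lt') // => /eqP e1.
by have := index_nth_le (costs I a) (find p (iota 0 B)); rewrite e1 eqx leqNgt lt'.
Qed.

Opaque IsRep.

Lemma ev_NextRep env e i : env 0 = B -> ev B e env m = i -> i < nA I ->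
  ev B (NextRep e) env m = find (fun y => [&& m (B + i) < y, y < psize I i & rep I i y])
    (iota 0 B).
Proof.
move=> e0 ei lti; rewrite /NextRep [LHS]/= ei.
have -> : m (upd env 7 i 0 + upd env 7 i 7) = m (B + i) by rewrite -[upd env 7 i 0]/(env 0) e0.
apply: find_iotaE => y yB; rewrite !andB !ltB (@ev_Len _ _ i) //; last by lia.
rewrite -/(psize I i) [ev B (Var 12) _ _]/= [ev B (Var 11) _ _]/=; congr andb.
by case: ltnP => //= ys; rewrite (@ev_IsRep _ _ _ i y).
Qed.

Opaque Valid Viol.

Lemma ev_Ok env : env 0 = B -> reflect (good I c) (ev B Ok env m != 0).
Proof.
move=> e0; rewrite /Ok notB ltB [ev B Bnd _ _]/= e0 [ev B (Find _ _) _ _]/=.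
rewrite -[X in _ < X](size_iota 0 B) -has_find.
apply: (iffP hasPn) => [h i lt | gd x].
  have /h : i \in iota 0 B by rewrite mem_iota /=; lia.
  rewrite andB ltB ev_NA [ev B (Var 15) _ _]/= lt /= (@ev_Valid _ _ i) //.
  case: ltnP => v; last by [].
  by rewrite (@ev_Viol _ _ i).
rewrite mem_iota add0n /= => xB; rewrite andB ltB ev_NA [ev B (Var 15) _ _]/=.
case: ltnP => //= lt; have [v nv] := gd x lt.
by rewrite (@ev_Valid _ _ x) // v (@ev_Viol _ _ x).
Qed.

Lemma ev_Sum env : env 0 = B -> (forall a, a < nA I -> c a < size (pl I a)) ->
  ev B Sum env m = costc I c.
Proof.
move=> e0 h; rewrite /Sum [LHS]/=; set f := fun j acc : nat => _.
suff hk k : iteri k f 0 = \sum_(0 <= a < minn k (nA I)) cst I (nth 0 (pl I a) (c a)).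
  by rewrite hk (minn_idPr _) //; lia.
elim: k => [|k IH]; first by rewrite min0n big_geq.
rewrite iteriS IH /f ltB ev_NA [ev B (Var 17) _ _]/=; case: ltnP => lt /=.
  rewrite (minn_idPl lt) big_nat_recr //= -(minn_idPl (ltnW lt)).
  rewrite (@ev_CostAt _ _ _ k (c k)) ?h //; last exact: ev_Cur.
  by rewrite /costs (nth_map 0) ?h // (minn_idPl (ltnW lt)).
by rewrite (minn_idPr _) // ltnW.
Qed.

End Eval.

Opaque Lt And Not Eq Off Len Elt CostAt Rank Cur IsRep Viol NextSame NextRep Valid Ok Sum.

(** * Correctness of the memory transformations *)

Lemma iteri_inv (T : Type) (P : nat -> T -> Prop) f x k : P 0 x ->
  (forall j y, j < k -> P j y -> P j.+1 (f j y)) -> P k (iteri k f x).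
Proof.
move=> P0 step; elim: k step => //= k IH step.
by apply: (step) => //; apply: IH => j y lt; apply: step; apply: ltnW.
Qed.

Definition same_out (lo hi : nat) (m m' : nat -> nat) :=
  forall y, y < lo \/ hi <= y -> m' y = m y.

(** Round [j] writes only cell [base + j]. The predicate [P] marks the indices whose value matters,
    since loops run to [B] and hence past the agents. *)
Lemma copy_loop base k (F : nat -> (nat -> nat) -> nat -> nat) (P : pred nat) g m0 :
  (forall j m, j < k -> same_out base (base + k) m0 m ->
     exists v, F j m = upd m (base + j) v /\ (P j -> v = g j)) ->
  same_out base (base + k) m0 (iteri k F m0) /\
  (forall j, j < k -> P j -> iteri k F m0 (base + j) = g j).
Proof.
move=> step.
have [] := @iteri_inv _ (fun i m => same_out base (base + k) m0 m /\
   forall j, j < i -> P j -> m (base + j) = g j) F m0 k _ _ => //.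
move=> j m lt [so h]; have [v [-> vE]] := step j m lt so; split=> [y out | i].
  by rewrite /upd; case: eqP => [e | _]; [lia | exact: so].
rewrite ltnS leq_eqVlt /upd eqn_add2l => /orP[/eqP -> | lti Pi].
  by rewrite eqxx => /vE.
by rewrite ltn_eqF // h.
Qed.

Section Dynamics.
Variables (I : instance) (B : nat).
Hypothesis BE : B = input_size I.
Notation env0 := (fun _ : nat => B).

Let szI : 2 + nB I + (nA I + nB I) <= B.
Proof. by rewrite BE input_size_ge. Qed.

Definition st (m : nat -> nat) a := m (B + a).
Definition cu (m : nat -> nat) a := m (B + (B + a)).
Definition be (m : nat -> nat) a := m (B + (B + (B + a))).
Definition cell (m : nat -> nat) k := m (B + (B + (B + (B + k)))).

Lemma same_out_inp lo hi m m' : B <= lo -> same_out lo hi m m' -> inp I m -> inp I m'.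
Proof. by move=> le so im x xB; rewrite so ?im //; left; lia. Qed.

Lemma copy_startP m : same_out (B + B) (B + B + B) m (ss B copy_start env0 m) /\
  (forall a, a < B -> cu (ss B copy_start env0 m) a = st m a).
Proof.
have [|so h] := @copy_loop (B + B) B
  (fun j m' => ss B (St (CurA (Var 14)) (Get (StartA (Var 14)))) (upd env0 14 j) m')
  xpredT (st m) m; last first.
  split=> // a lt; rewrite /cu addnA; exact: h.
move=> j m' lt so; exists (m' (B + j)); split; first by rewrite /= /upd /= addnA.
by move=> _; rewrite so //; left; lia.
Qed.

Definition next_same m j := find (fun y => [&& cu m j < y, y < psize I j &
    nth 0 (costs I j) y == nth 0 (costs I j) (cu m j)]) (iota 0 B).

Lemma bumpP env m j : env 0 = B -> env 13 = j -> inp I m ->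
  ss B bump env m =
    if [&& j < nA I, cu m j < size (pl I j) & viol I (cu m) j]
    then upd m (B + (B + j)) (next_same m j) else m.
Proof.
move=> e0 ej im; rewrite [LHS]/= !andB ltB (ev_NA BE im) [ev B (Var 13) _ _]/= ej.
case: ltnP => //= lt; rewrite (@ev_Valid _ _ _ BE im _ _ j) //.
case: ltnP => //= v; rewrite (@ev_Viol _ _ _ BE im _ _ j) //.
by case: ifP => // _; rewrite e0 (@ev_NextSame _ _ _ BE im _ _ j).
Qed.

Definition frame := same_out (B + B) (B + B + B).

Lemma frame_inp m m' : frame m m' -> inp I m -> inp I m'.
Proof. by apply: same_out_inp; lia. Qed.

Lemma frame_trans m m' m'' : frame m m' -> frame m' m'' -> frame m m''.
Proof. by move=> f f' y h; rewrite f' // f. Qed.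

Lemma bump_frame env m j : env 0 = B -> env 13 = j -> inp I m -> frame m (ss B bump env m).
Proof.
move=> e0 ej im; rewrite (bumpP e0 ej im); case: ifP => // /and3P[lt _ _] y h.
by rewrite /upd; case: eqP => // e; lia.
Qed.

Lemma round_frame r m : inp I m -> frame m (ss B round (upd env0 14 r) m).
Proof.
move=> im; apply: (@iteri_inv _ (fun _ m' => frame m m')) => // j m' lt f.
apply: frame_trans (f) _.
exact: bump_frame (frame_inp f im).
Qed.

Lemma rounds_frame m : inp I m -> frame m (ss B rounds env0 m).
Proof.
move=> im; apply: (@iteri_inv _ (fun _ m' => frame m m')) => // j m' lt f.
apply: frame_trans (f) _.
exact: round_frame (frame_inp f im).
Qed.

(** * The moves compared with a fixed good vector *)

Section Upper.
Variable c : nat -> nat.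
Hypothesis gc : good I c.

Definition upper m := forall a, a < nA I -> cu m a <= c a /\
  nth 0 (costs I a) (cu m a) = nth 0 (costs I a) (c a).

(* Every round that moves an agent increases this sum, which stays below [B];
   hence [B] rounds suffice. *)
Let total m := \sum_(0 <= a < nA I) cu m a.

(** If agent [i] already stood at [c i], the agent envying her now would envy her in [c] too, as her
    own position in [c] is no better; but [c] is good. *)
Lemma upper_viol m i : upper m -> i < nA I -> viol I (cu m) i -> cu m i < c i.
Proof.
move=> up lt vi; have [le ce] := up i lt; rewrite ltn_neqAle le andbT.
apply/eqP => e; have [_ /negP] := gc lt; apply; move: vi; rewrite /viol e.
case/hasP => a ain /and3P[pa ia r]; apply/hasP; exists a => //; rewrite pa r andbT /=.
apply: leq_trans ia _; have [|//] := up a _; by move: ain; rewrite mem_iota.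
Qed.

Lemma bump_upper m j : upper m -> j < nA I -> viol I (cu m) j ->
  let m' := upd m (B + (B + j)) (next_same m j) in upper m' /\ total m < total m'.
Proof.
move=> up lt vi m'; have ltc := upper_viol up lt vi.
have [cs _] := gc lt; have [_ ce] := up j lt.
have [h1 h2] := find_iotaP (fun y => [&& cu m j < y, y < psize I j &
    nth 0 (costs I j) y == nth 0 (costs I j) (cu m j)]) B.
have jK : j < nA I + nB I by lia.
have cB : c j < B by rewrite BE; apply: ltn_trans cs (psize_lt jK).
(* The position [c j] is itself a candidate of the search, so the move cannot overshoot it. *)
have le : next_same m j <= c j by apply: h2; rewrite // ltc cs -ce eqxx.
have /and3P[gt _ /eqP ne] := h1 (leq_ltn_trans le cB).
have cuE a : cu m' a = if a == j then next_same m j else cu m a.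
  by rewrite /cu /m' /upd !eqn_add2l.
split=> [a lta | ].
  rewrite cuE; case: eqP => [-> | _]; last exact: up.
  by split=> //; rewrite -ce -ne.
rewrite /total !big_mkord (bigD1 (Ordinal lt)) //= [X in _ < X](bigD1 (Ordinal lt)) //=.
rewrite cuE eqxx [X in _ < _ + X](eq_bigr (fun a : 'I_(nA I) => cu m a)) ?ltn_add2r //.
by move=> a; rewrite cuE -val_eqE /= => /negbTE ->.
Qed.

(** The violation recorded beside the growth of [total] refers to the state before the round; it
    shows later that no agent moves once violations are gone. *)
Lemma round_upper r m : inp I m -> upper m ->
  let m' := ss B round (upd env0 14 r) m in upper m' /\
  (total m < total m' /\ (exists2 i, i < nA I & viol I (cu m) i) \/
   m' = m /\ forall i, i < nA I -> ~~ viol I (cu m) i).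
Proof.
move=> im up.
have [] := @iteri_inv _ (fun j m' => [/\ frame m m', upper m' &
  total m < total m' /\ (exists2 i, i < nA I & viol I (cu m) i) \/
   m' = m /\ forall i, i < j -> i < nA I -> ~~ viol I (cu m) i])
  (fun j m' => ss B bump (upd (upd env0 14 r) 13 j) m') m B _ _.
- by split=> //; right.
- move=> j m' _ [f up' dis].
  have im' := frame_inp f im.
  have f' := frame_trans f (@bump_frame (upd (upd env0 14 r) 13 j) m' j erefl erefl im').
  split=> //; rewrite (@bumpP (upd (upd env0 14 r) 13 j) m' j erefl erefl im').
    by case: ifP => // /and3P[lt _ vi]; have [] := bump_upper up' lt vi.
  case: ifP => [/and3P[lt _ vi] | nb].
    have [_ lt'] := bump_upper up' lt vi; left; case: dis => [[lt'' ex] | [e nv]].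
      by split=> //; apply: ltn_trans lt'.
    (* This is the first move of the round, so its violation is one of [m]. *)
    by subst m'; split=> //; exists j.
  case: dis => [|[e nv]]; [by left | right; split=> // i].
  rewrite ltnS leq_eqVlt => /orP[/eqP -> | ]; last exact: nv.
  move=> lt; apply/negP => vi; move: nb; rewrite e lt vi andbT /=.
  by have [le _] := up j lt; have [cs _] := gc lt; rewrite (leq_ltn_trans le).
- move=> _ up' dis; split=> //; case: dis => [|[e nv]]; [by left | right].
  by split=> // i lt; apply: nv => //; lia.
Qed.

Lemma total_lt m : upper m -> total m < B.
Proof.
(* Each position is less than the length of its list, so the sum is paid for by the words that the
   lists occupy. *)
move=> up; have h k : k <= nA I -> \sum_(0 <= a < k) cu m a <= off I k - 2.
  elim: k => [|k IH] lt; first by rewrite big_geq.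
  rewrite big_nat_recr //= offS; last by lia.
  have := IH (ltnW lt); have [le _] := up k lt; have [cs _] := gc lt.
  by have := @off_ge I k; lia.
have := h _ (leqnn _); have := @off_mono I (nA I) (nA I + nB I).
by rewrite -input_sizeE -BE /total; lia.
Qed.

Lemma rounds_good m : inp I m -> upper m ->
  upper (ss B rounds env0 m) /\ good I (cu (ss B rounds env0 m)).
Proof.
move=> im up.
have [] := @iteri_inv _ (fun j m' => [/\ frame m m', upper m' &
  j <= total m' \/ forall i, i < nA I -> ~~ viol I (cu m') i])
  (fun j m' => ss B round (upd env0 14 j) m') m B _ _.
- by split=> //; left.
- move=> j m' _ [f up' dis]; have im' := frame_inp f im.
  have f' := frame_trans f (round_frame j im').
  have [up'' [[lt [i lti vi]] | [-> nv]]] := round_upper j im' up'; split=> //; last by right.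
  by case: dis => [le | /(_ i lti)]; [left; apply: leq_ltn_trans lt | rewrite vi].
- move=> _ up' dis; split=> // a lt; split.
    by have [le _] := up' a lt; have [cs _] := gc lt; apply: leq_ltn_trans cs.
  case: dis => [le|]; last exact.
  by have := leq_trans (total_lt up') le; rewrite ltnn.
Qed.

Lemma upper_cost m : upper m -> costc I (cu m) = costc I c.
Proof.
move=> up; rewrite /costc !big_nat; apply: eq_bigr => a /andP[_ lt].
have [le e] := up a lt; have [cs _] := gc lt; move: e.
by rewrite /costs !(nth_map 0) // (leq_ltn_trans le).
Qed.

Lemma start_upper m : (forall a, a < nA I -> cu m a = first_pos I c a) -> upper m.
Proof.
move=> h a lt; rewrite h //; have [cs _] := gc lt.
split; first exact: index_nth_le.
by rewrite nth_index // mem_nth // size_costs.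
Qed.

End Upper.

(** * Recording the best matching, and the invariant of the enumeration *)

Lemma save_bestP m : inp I m -> (forall a, a < nA I -> cu m a < size (pl I a)) ->
  let m' := ss B save_best env0 m in
  [/\ same_out (B + B + B) (B + B + B + B + 2) m m',
      forall a, a < nA I -> be m' a = nth 0 (pl I a) (cu m a),
      cell m' 1 = costc I (cu m) & cell m' 0 = 1].
Proof.
move=> im v.
have [|so h] := @copy_loop (B + B + B) B
  (fun j m' => ss B (St (BestA (Var 14)) (Elt (Var 14) (Cur (Var 14)))) (upd env0 14 j) m')
  (fun a => a < nA I) (fun a => nth 0 (pl I a) (cu m a)) m; last first.
  move=> m'; rewrite {}/m' /save_best.
  set m1 := iteri _ _ _ in so h.
  rewrite [ss _ _ _ _](_ : _ = upd (upd m1 (B + (B + (B + (B + 1)))) (ev B Sum env0 m1))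
    (B + (B + (B + (B + 0)))) 1) //.
  have im1 : inp I m1 by apply: same_out_inp so im; lia.
  have cuE a : a < nA I -> cu m1 a = cu m a by move=> lt; rewrite /cu so //; left; lia.
  rewrite (ev_Sum BE im1) //; last by move=> a lt; rewrite -/(cu m1 a) cuE // v.
  split.
  + move=> y out; rewrite /upd; case: eqP => [e|_]; first by lia.
    by case: eqP => [e|_]; [lia | apply: so; lia].
  + move=> a lt; rewrite /be /upd; case: eqP => [e|_]; first by lia.
    by case: eqP => [e|_]; [lia | rewrite !addnA h //; lia].
  + rewrite /cell /upd eqxx; case: eqP => [e|_]; first by lia.
    by rewrite /costc !big_nat; apply: eq_bigr => a /andP[_ lt]; rewrite -/(cu m1 a) cuE.
  + by rewrite /cell /upd eqxx.
move=> j m' lt so.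
eexists; split; first by rewrite /= {1 2 3 4}/upd /= !addnA.
move=> lt'; have im' : inp I m' by apply: same_out_inp so im; lia.
have cuE : cu m' j = cu m j by rewrite /cu so //; left; lia.
by apply: (@ev_Elt _ _ _ BE im' _ _ _ j (cu m j)) => //; [lia | exact: v].
Qed.

Definition bestcost_ok m := cell m 0 != 0 -> exists c, [/\ good I c,
  forall a, a < nA I -> be m a = nth 0 (pl I a) (c a) & cell m 1 = costc I c].

(** Cases are numbered by their odometer values; those below [q] have been examined. *)
Definition covered (q : nat) m := forall c, good I c ->
  value (rep I) (psize I) (nA I) (first_pos I c) < q ->
  cell m 0 != 0 /\ cell m 1 <= costc I c.

Definition digits_ok m := forall a, a < nA I -> digit_ok (rep I) (psize I) a (st m a).

Definition invar q m := [/\ inp I m, digits_ok m, bestcost_ok m & covered q m].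

Lemma updateP m : inp I m ->
  [/\ good I (cu m), cell m 0 != 0 -> costc I (cu m) < cell m 1 &
      ss B update env0 m = ss B save_best env0 m] \/
  (good I (cu m) -> cell m 0 != 0 /\ cell m 1 <= costc I (cu m)) /\
  ss B update env0 m = m.
Proof.
move=> im; rewrite /update [ss _ _ _ _]/= andB.
case: (@ev_Ok I B m BE im env0 erefl) => gc /=; last by right.
have lt1 : (ev B (Lt Sum (Get (Cell 1))) env0 m != 0) = (costc I (cu m) < cell m 1).
  by rewrite ltB (ev_Sum BE im) // => a /gc[].
rewrite -/(cell m 0); case f: (cell m 0 != 0) => /=; last by left.
rewrite lt1; case: ltnP => le; [by left | by right].
Qed.

Definition next_rep m j :=
  find (fun y => [&& st m j < y, y < psize I j & rep I j y]) (iota 0 B).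

Lemma carry_stepP env m j : env 0 = B -> env 14 = j -> inp I m ->
  ss B carry_step env m =
    if (j < nA I) && (cell m 2 != 0) then
      if next_rep m j < B
      then upd (upd m (B + j) (next_rep m j)) (B + (B + (B + (B + 2)))) 0
      else upd m (B + j) 0
    else m.
Proof.
move=> e0 ej im.
have cE : ev B (Get (Cell 2)) env m = cell m 2 by rewrite /= e0.
rewrite [LHS]/= andB ltB (ev_NA BE im) cE [ev B (Var 14) _ _]/= ej e0.
case: ltnP => //= lt.
have nE : ev B (NextRep (Var 14)) env m = next_rep m j.
  by rewrite (@ev_NextRep _ _ _ BE im _ _ j).
by case: (cell m 2 != 0); rewrite // ltB nE [ev B Bnd _ _]/= e0.
Qed.

(** The carry is the overflow digit of an increment, of weight [weight (rep I) (psize I) (nA I)]. *)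
Lemma advanceP m : inp I m -> digits_ok m ->
  let m' := ss B advance env0 m in
  [/\ digits_ok m', cell m' 2 <= 1,
    forall y, y < B \/ B + nA I <= y -> y != B + (B + (B + (B + 2))) -> m' y = m y &
    value (rep I) (psize I) (nA I) (st m') + weight (rep I) (psize I) (nA I) * cell m' 2 =
    (value (rep I) (psize I) (nA I) (st m)).+1].
Proof.
move=> im ok m'; rewrite {}/m'.
set k2 := B + (B + (B + (B + 2))).
set V := value _ _; set W := weight _ _.
(* The first [j] digits together with the carry represent the old prefix plus one, and later digits
   are untouched; [minn] freezes this past the last agent. *)
have [] := @iteri_inv _ (fun j m' => [/\ digits_ok m', cell m' 2 <= 1,
    (forall y, y < B \/ B + nA I <= y -> y != k2 -> m' y = m y),
    (forall a, j <= a -> a < nA I -> st m' a = st m a) &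
    V (minn j (nA I)) (st m') + W (minn j (nA I)) * cell m' 2 = (V (minn j (nA I)) (st m)).+1])
  (fun j m' => ss B carry_step (upd env0 14 j) m') (upd m k2 1) B _ _; last first.
- by move=> ok' c1 so _; rewrite (minn_idPr _); [split | lia].
- move=> j m' _ [ok' c1 so rest ve].
  have im' : inp I m'.
    move=> y yB; rewrite so ?im //; first by left; lia.
    by apply/eqP => e; rewrite /k2 in e; lia.
  rewrite (@carry_stepP (upd env0 14 j) m' j erefl erefl im') -/k2.
  case: ltnP => ltj /=; last first.
    have -> : minn j.+1 (nA I) = nA I by lia.
    move: ve; have -> : minn j (nA I) = nA I by lia.
    by split=> // a lja lta; lia.
  have minE : minn j.+1 (nA I) = j.+1 by lia.
  have minE' : minn j (nA I) = j by lia.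
  rewrite minE' in ve; rewrite minE.
  have stj : st m' j = st m j by apply: rest.
  case: eqP => [c0 | /eqP c0] /=.
    split=> //; first by move=> a ja; apply: rest; lia.
    rewrite /V /= -/V c0 muln0 addn0 stj.
    by move: ve; rewrite c0 muln0 addn0 => ->; rewrite addSn.
  have ce : cell m' 2 = 1 by lia.
  have jB : j < B by lia.
  have psB : psize I j <= B by rewrite BE ltnW // psize_lt //; lia.
  have := dig_next psB (ok' j ltj); rewrite -/(next_rep m' j).
  set v := next_rep m' j; move=> dn.
  rewrite ce muln1 in ve.
  have eqk2 a : a < nA I -> (B + a == k2) = false by move=> lt; apply/eqP; rewrite /k2; lia.
  (* If a next digit exists, the weight of the carry becomes one more unit of digit [j]. *)
  case: ltnP dn => vB dv.
    case: dv => vs rv dv.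
    set m'' := upd _ _ _.
    have stE a : a < nA I -> st m'' a = if a == j then v else st m' a.
      by move=> lt; rewrite /st /m'' /upd eqk2 // eqn_add2l.
    have c0'' : cell m'' 2 = 0 by rewrite /cell /m'' /upd eqxx.
    split.
    + move=> a lt; rewrite stE //; case: eqP => [-> | _]; last exact: ok'.
      by right.
    + by rewrite c0''.
    + move=> y out ne; rewrite /m'' /upd (negbTE ne); case: eqP => [e | _]; first by lia.
      exact: so.
    + move=> a lja lt; rewrite stE //; case: eqP => [e | _]; first by lia.
      by apply: rest => //; lia.
    + rewrite c0'' muln0 addn0 /V /= -/V stE // eqxx dv mulnS addnA.
      rewrite -stj -addSn -ve; congr (_ + _ + _).
      by apply: eq_value => a lt; rewrite stE ?ltn_eqF //; lia.
  set m'' := upd _ _ _.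
  have stE a : a < nA I -> st m'' a = if a == j then 0 else st m' a.
    by move=> lt; rewrite /st /m'' /upd eqn_add2l.
  have c1'' : cell m'' 2 = 1.
    by rewrite -[RHS]ce /cell /m'' /upd; case: eqP => // e; lia.
  split.
  + move=> a lt; rewrite stE //; case: eqP => _; last exact: ok'.
    by left.
  + by rewrite c1''.
  + move=> y out ne; rewrite /m'' /upd; case: eqP => [e | _]; first by lia.
    exact: so.
  + move=> a lja lt; rewrite stE //; case: eqP => [e | _]; first by lia.
    by apply: rest => //; lia.
  (* The maximal digit and the carry together make up one unit of the next weight, which the new
     carry represents. *)
  + rewrite c1'' muln1 /V /= -/V /W /= -/W stE // eqxx [dig _ _ 0]/= muln0 addn0.
    rewrite -dv mulnS -stj -addSn -ve addnA; congr (_ + _ + _).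
    by apply: eq_value => a lt; rewrite stE ?ltn_eqF //; lia.
have stE a : a < nA I -> st (upd m k2 1) a = st m a.
  by move=> lt; rewrite /st /upd; case: eqP => // e; rewrite /k2 in e; lia.
split.
- by move=> a lt; rewrite stE //; apply: ok.
- by rewrite /cell /upd eqxx.
- by move=> y _ /negbTE ne; rewrite /upd ne.
- by move=> a _; apply: stE.
- by rewrite min0n /= /cell /upd eqxx.
Qed.

Notation weightI := (weight (rep I) (psize I) (nA I)).
Notation valueI := (value (rep I) (psize I) (nA I)).

(** The pass treats case number [q]. If the case contains a good vector, the rounds reach one of the
    same cost, so a single comparison covers the whole case. *)
Lemma bodyP q m : invar q m -> q = valueI (st m) ->
  let m' := ss B body env0 m in
  [/\ invar q.+1 m', cell m' 2 <= 1 & valueI (st m') + weightI * cell m' 2 = q.+1].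
Proof.
move=> [im dm bm cm] qE m'.
have mE : m' = ss B advance env0 (ss B update env0 (ss B rounds env0
  (ss B copy_start env0 m))) by [].
rewrite {}mE {m'}.
have [f1 cu1] := copy_startP m; set m1 := ss B copy_start env0 m in f1 cu1 *.
have im1 := frame_inp f1 im.
have f2 := frame_trans f1 (rounds_frame im1).
set m2 := ss B rounds env0 m1 in f2 *.
have im2 := frame_inp f2 im.
have st2 a : a < nA I -> st m2 a = st m a by move=> lt; rewrite /st f2 //; left; lia.
have cell2 k : cell m2 k = cell m k by rewrite /cell f2 //; right; lia.
have be2 a : be m2 a = be m a by rewrite /be f2 //; right; lia.
(* By uniqueness of the representation the odometer shows the first positions of [c], so the rounds
   start at or before [c]. *)
have best2 c : good I c -> valueI (first_pos I c) = q ->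
    good I (cu m2) /\ costc I (cu m2) = costc I c.
  move=> gc vq; have fpE a : a < nA I -> first_pos I c a = st m a.
    apply: (value_inj (r := rep I) (n := psize I)) => //; last by rewrite vq.
    by move=> b /gc[lt _]; apply: first_pos_ok.
  have up1 : upper c m1.
    by apply: start_upper gc _ _ => a lt; rewrite cu1 ?fpE //; lia.
  have [up2 g2] := rounds_good gc im1 up1.
  by split=> //; apply: upper_cost gc _ up2.
set m3 := ss B update env0 m2.
have [im3 dm3 bm3 cm3] : invar q.+1 m3.
  case: (updateP im2) => [[g2 lt mE] | [h mE]]; rewrite /m3 mE; last first.
    split=> //.
    - by move=> a la; rewrite st2 //; apply: dm.
    - rewrite /bestcost_ok !cell2 => /bm[c [gc bc cc]]; exists c; split=> // a la.
      by rewrite be2 bc.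
    - move=> c gc; rewrite ltnS leq_eqVlt => /orP[/eqP /(best2 c gc) [g <-] | ].
        exact: h.
      by rewrite !cell2; apply: cm.
  have [so bE c1 c0] := save_bestP im2 (fun a la => proj1 (g2 a la)).
  split.
  - by apply: same_out_inp so im2; lia.
  - by move=> a la; rewrite /st so -/(st m2 a) ?st2; [apply: dm | | left; lia].
  - by move=> _; exists (cu m2).
  - move=> c gc; rewrite c0 c1 ltnS leq_eqVlt => /orP[/eqP /(best2 c gc) [_ ->] // | lt'].
    have [f le] := cm c gc lt'; split=> //; apply: leq_trans le.
    by rewrite ltnW // -(cell2 1) lt // cell2.
have vq3 : valueI (st m3) = q.
  rewrite qE; apply: eq_value => a la.
  case: (updateP im2) => [[g2 _ mE] | [_ mE]]; rewrite /m3 mE; last exact: st2.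
  have [so _ _ _] := save_bestP im2 (fun a la => proj1 (g2 a la)).
  by rewrite /st so -/(st m2 a) ?st2 //; left; lia.
have := advanceP im3 dm3; rewrite vq3.
case=> ok c2 so ve; split=> //.
have soc k : k < 2 -> cell (ss B advance env0 m3) k = cell m3 k.
  by move=> lt; rewrite /cell so //; [right; lia | apply/eqP; lia].
split=> //.
- move=> y yB; rewrite so ?im3 //; first by left; lia.
  by apply/eqP; lia.
- rewrite /bestcost_ok !soc // => /bm3[c [gc bc cc]]; exists c; split=> // a la.
  by rewrite -bc // /be so //; [right; lia | apply/eqP; lia].
- by move=> c gc vlt; rewrite !soc //; apply: cm3.
Qed.

Lemma outputP m : (forall a, a < B -> ss B output env0 m a = be m a) /\
  cell (ss B output env0 m) 0 = cell m 0.
Proof.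
have [|so h] := @copy_loop 0 B
  (fun j m' => ss B (St (Var 14) (Get (BestA (Var 14)))) (upd env0 14 j) m')
  xpredT (be m) m; last first.
  by split=> [a lt|]; [exact: h | apply: so; right; lia].
move=> j m' lt so; exists (be m' j); split=> // _.
by rewrite /be so //; right; lia.
Qed.

Lemma covered_all m : covered weightI m -> forall c, good I c ->
  cell m 0 != 0 /\ cell m 1 <= costc I c.
Proof.
move=> cm c gc; apply: cm => //; apply: value_lt => a la.
by apply: first_pos_ok; have [] := gc a la.
Qed.

(** Cells beyond the input are 0, so the odometer, the carry and the found flag start cleared. *)
Lemma init_invar m : m =1 nth 0 (encode I) -> invar 0 m /\ 0 = valueI (st m) /\ cell m 2 = 0.
Proof.
move=> mE; have z x : B <= x -> m x = 0 by move=> le; rewrite mE nth_default // -/(input_size I) -BE.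
have st0 a : st m a = 0 by apply: z; lia.
split; last by rewrite /cell z ?value0 //; lia.
split=> [x _ | a _ | | c _ //]; first exact: mE.
- by rewrite st0; left.
- by rewrite /bestcost_ok /cell z //; lia.
Qed.

End Dynamics.

(** * The running time *)

Lemma good_answer I (s : state) (m : nat -> nat) B : B = input_size I ->
  covered I B (weight (rep I) (psize I) (nA I)) m -> bestcost_ok I B m ->
  regs s 0 = cell B m 0 -> (forall a, a < nA I -> mem s a = be B m a) ->
  minsum_answer I s.
Proof.
move=> BE cm bm r0 ms; rewrite /minsum_answer r0; case: eqP => [c0 | /eqP c0].
  move=> M; apply/negP => fM; have [c lk] := feasible_link fM.
  have [] := covered_all cm (proj1 (link_feasible lk) fM).
  by rewrite c0.
have [c [gc bc cc]] := bm c0; have [M lk] := good_link gc.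
exists M; split.
  split=> [|M' fM']; first by apply/(link_feasible lk).
  have [c' lk'] := feasible_link fM'.
  rewrite (link_cost lk) (link_cost lk') -cc.
  by have [] := covered_all cm (proj1 (link_feasible lk') fM').
move=> a; have [p [Mp _ _]] := lk a; exists p => //.
by rewrite ms // bc // (link_nth lk Mp).
Qed.

(** * The complete program and its step count *)

Definition rho1 : nat -> nat := fun=> 1.
Definition nlists := Plus NA (Get (Num 1)).
Definition running := Minus (Num 1) (Get (Cell 2)).

(** The bound is bootstrapped: [nlists] is loop-free and works with bound 0, its value suffices as
    bound for [Off nlists], and that in turn yields the input size. *)
Definition main : cmd :=
  Seq (comp nlists rho1 2) (Seq (mov 1 2 3)
    (Seq (comp (Off nlists) rho1 2) (Seq (mov 1 2 3)
      (Seq (comp running rho1 2)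
        (Seq (While 2 (Seq (compS body rho1 2) (comp running rho1 2)))
          (Seq (compS output rho1 2)
            (Seq (comp (Get (Cell 0)) rho1 2) (mov 0 2 3)))))))).

(** The inner 0 stands in the place of [Off nlists], whose loop bound is not [B]; its time is added
    separately. *)
Definition fixed_time B := tm 0 nlists + (2 + (0 + (2 + (tm B running + (1 +
  (tmS B output + (tm B (Get (Cell 0)) + 2))))))).
Definition body_time B := tmS B body + tm B running.

Lemma interp1 B s : regs s 1 = B -> interp B 2 rho1 (fun=> B) s.
Proof. by move=> e; split. Qed.

Lemma main_correct I : exists t s, [/\ exec main (initial_state I) t s, minsum_answer I s &
  t <= fixed_time (input_size I) + tm (nA I + nB I) (Off nlists) +
       weight (rep I) (psize I) (nA I) * (body_time (input_size I) + 1)].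
Proof.
set B := input_size I; set W := weight _ _ _.
set T := _ + _ + _.
suff [t [s [ex le ans]]] : runs main (initial_state I) T (minsum_answer I) by exists t, s.
have -> : T = tm 0 nlists + (2 + (tm (nA I + nB I) (Off nlists) + (2 + (tm B running +
  ((W * (body_time B + 1) + 1) + (tmS B output + (tm B (Get (Cell 0)) + 2))))))).
  by rewrite /T /fixed_time; lia.
have im : inp I (nth 0 (encode I)) by [].
rewrite /main; apply: runs_seq.
apply: runs_weaken (comp_correct (B := 0) nlists (interp1 _)) => // s1 [m1 a1 v1].
rewrite [ev _ _ _ _]/= in v1.
apply: runs_seq; apply: runs_mov => //.
set s2 := set_reg _ _ _.
have r2 : regs s2 1 = nA I + nB I by rewrite /s2 /= /upd /= v1.
apply: runs_seq.
apply: runs_weaken (comp_correct (Off nlists) (interp1 r2)) => // s3 [m3 a3 v3].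
have mE2 : mem s2 = nth 0 (encode I) by [].
have szI := input_size_ge I.
have v3' : regs s3 2 = B.
  by rewrite v3 mE2 (ev_Off im) //= -?input_sizeE //.
apply: runs_seq; apply: runs_mov => //.
set s4 := set_reg _ _ _.
have r4 : regs s4 1 = B by rewrite /s4 /= /upd /= v3'.
have m4 : mem s4 = nth 0 (encode I) by rewrite /s4 /= m3 mE2.
apply: runs_seq.
apply: runs_weaken (comp_correct running (interp1 r4)) => // s5 [m5 a5 v5].
rewrite m4 in m5 v5.
have r5 : regs s5 1 = B by rewrite a5.
apply: runs_seq.
(* While the carry is 0, [W - q] cases remain; once it is set, the loop register is 0 and all [W]
   cases are covered. *)
pose Inv k s := exists q, [/\ regs s 1 = B, regs s 2 = 1 - cell B (mem s) 2, invar I B q (mem s) &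
  cell B (mem s) 2 = 0 /\ q = value (rep I) (psize I) (nA I) (st B (mem s)) /\ k = W - q \/
  cell B (mem s) 2 = 1 /\ q = W].
have BE : B = input_size I by [].
apply: (@runs_while _ _ _ W _ Inv).
  have [inv [v0 c0]] := @init_invar I B BE (mem s5) (fun x => congr1 (fun f => f x) m5).
  exists 0; split=> //; first by rewrite v5 m5.
  by left; rewrite subn0.
move=> n s6 [q [r6 r62 inv dis]]; rewrite r62.
case: dis => [[c0 [qE nE]] | [c1 qE]]; last first.
  rewrite c1 /=; apply: runs_seq.
  apply: runs_weaken (compS_correct output (interp1 r6)) => // s7 [m7 a7].
  have r7 : regs s7 1 = B by rewrite a7.
  apply: runs_seq.
  apply: runs_weaken (comp_correct (Get (Cell 0)) (interp1 r7)) => // s8 [m8 a8 v8].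
  apply: runs_mov => //.
  have [ms c0] := @outputP I B BE (mem s6).
  have [_ _ bm cm] := inv; rewrite qE in cm.
  apply: (good_answer BE cm bm); first by rewrite /= /upd /= v8 m7 -c0.
  by move=> a la; rewrite /= m8 m7 ms //; lia.
have [_ dm _ _] := inv.
have qW : q < W by rewrite qE; apply: value_lt.
rewrite c0 /=; exists (W - q.+1); first by lia.
apply: runs_seq.
apply: runs_weaken (compS_correct body (interp1 r6)) => // s7 [m7 a7].
have r7 : regs s7 1 = B by rewrite a7.
apply: runs_weaken (comp_correct running (interp1 r7)) => // s8 [m8 a8 v8].
have [inv' c2 ve] := bodyP BE inv qE.
exists (W - q.+1) => //; exists q.+1; split.
- by rewrite a8.
- by rewrite v8 m8.
- by rewrite m8 m7.
- rewrite m8 m7; case: (cell _ _ 2) c2 ve => [|[|//]] _ ve.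
    by left; split=> //; split=> //; rewrite -ve muln0 addn0.
  (* An overflow gives [W <= q.+1], while [q < W]. *)
  right; split=> //; rewrite muln1 in ve.
  by apply/eqP; rewrite eqn_leq qW -{1}ve leq_addl.
Qed.

Lemma leq_expn m n e : m <= n -> m ^ e <= n ^ e.
Proof. by case: e => // e; rewrite leq_exp2r. Qed.

(** The input has at least two words, so the successor of its size is at most its square; the
    exponent doubles. *)
Lemma poly_input_size f : poly f ->
  exists C d, forall I, f (input_size I) <= C * input_size I ^ d.
Proof.
move=> [C [d h]]; exists C, (2 * d) => I; apply: leq_trans (h _) _.
rewrite leq_mul2l expnM leq_expn ?orbT // expnS expn1.
have [N1 le] : 1 < input_size I /\ input_size I <= input_size I by have := input_size_ge I; lia.
by apply: leq_trans (leq_mul N1 le); lia.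
Qed.

(** The bound carries a polynomial factor in the input size. The maximum with 1 covers instances all
    of whose agents have empty lists, where [k] is 0 but the machine still takes steps. *)
Theorem theorem5 :
  exists (P : cmd) (C d : nat), forall I : instance,
    exists (t : nat) (s : state),
      [/\ exec P (initial_state I) t s,
          minsum_answer I s
        & t <= C * maxn (max_distinct_costs I) 1 ^ nA I * input_size I ^ d].
Proof.
(* The time of [Off nlists] is taken at [nA I + nB I]; replacing it by a monotone polynomial bound
   allows passing to the input size. *)
have [C1 [d1 h1]] := poly_tm (Off nlists).
have pf : poly (fun B => fixed_time B + C1 * B.+1 ^ d1 + (body_time B + 1)).
  apply: poly_add; first apply: poly_add.
  - by do !(exact: poly_const || exact: poly_tm || exact: poly_tmS || apply: poly_add).
  - by exists C1, d1.
  - exact: poly_add (poly_add (poly_tmS _) (poly_tm _)) (poly_const 1).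
have [C [d h]] := poly_input_size pf.
exists main, C, d => I; have [t [s [ex ans le]]] := main_correct I.
exists t, s; split=> //; apply: leq_trans le _.
set X := maxn _ _ ^ _.
(* Being positive, [X] absorbs the time spent outside the enumeration. *)
have X0 : 0 < X by rewrite expn_gt0 leq_max orbT.
rewrite mulnAC [leqRHS]mulnC; apply: leq_trans (_ : X * (fixed_time (input_size I) + C1 * (input_size I).+1 ^ d1 +
  (body_time (input_size I) + 1)) <= _); last by rewrite leq_mul2l h orbT.
rewrite [leqRHS]mulnDr leq_add ?leq_mul ?weight_le //.
apply: leq_trans (leq_pmull _ X0); rewrite leq_add2l.
apply: leq_trans (h1 _) _; rewrite leq_mul2l leq_expn ?orbT // ltnS.
by have := input_size_ge I; lia.
Qed.
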